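(* Let $1 \le k \le n$ and $0 \le s \le k$ be integers. Consider $k$ independent random points in $\mathbb{R}^n$, $s$ of which are uniformly distributed in the unit sphere $S^{n-1}$ and $k-s$ of which are uniformly distributed in the unit ball $B_2^n$. Let $V = V_{n,k,s}$ denote the $k$-dimensional volume of the symmetric convex hull of the random points. Then for every real $p \ge 0$, $$\mathbb{E} V^p = \left(\frac{2^k}{k!}\right)^p\left(1+\frac{p}{n}\right)^s\left(\frac{\Gamma(1+\frac{n}{2})}{\Gamma(1+\frac{n+p}{2})}\right)^k\prod_{i=1}^k\frac{\Gamma(\frac{n-k+i+p}{2})}{\Gamma(\frac{n-k+i}{2})}.$$
   Context: $B_2^n = \{x \in \mathbb{R}^n : \sum_{i=1}^n x_i^2 \le 1\}$ is the Euclidean unit ball and $S^{n-1} = \{x \in \mathbb{R}^n : \sum_{i=1}^n x_i^2 = 1\}$ is the Euclidean unit sphere; ''uniformly distributed'' means with respect to normalized Lebesgue measure on $B_2^n$ and normalized (rotation-invariant) surface measure on $S^{n-1}$, respectively. The symmetric convex hull of points $x_1,\ldots,x_k$ is $\mathrm{conv}\{\pm x_1,\ldots,\pm x_k\}$. $\Gamma$ is the Gamma function. *)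

(* Defs.v *)
(* MathComp-Analysis, over an arbitrary [R : realType]; R^n is ['rV[R]_n]. *)
From HB Require Import structures.
From mathcomp Require Import all_boot all_order all_algebra.
From mathcomp Require Import all_classical all_reals all_analysis.

Set Implicit Arguments.
Unset Strict Implicit.
Unset Printing Implicit Defensive.

Import Order.TTheory GRing.Theory Num.Theory.
Import numFieldNormedType.Exports.

Local Open Scope classical_set_scope.
Local Open Scope ring_scope.

(* The sigma-algebra on R^n is the one generated by the coordinate maps, as
   the library does for tuples; for ['rV[R]_n] it is the Borel sigma-algebra. *)
Definition measure_rV_display : measure_display -> measure_display.
Proof. exact. Qed.

Section measurable_rV.
Context {d} {T : sigmaRingType d}.
Variable n : nat.

Let coors : 'I_n -> 'rV[T]_n -> T := fun i x => x ord0 i.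

Let rV_set0 : g_sigma_preimage coors set0.
Proof. exact: sigma_algebra0. Qed.

Let rV_setC A : g_sigma_preimage coors A -> g_sigma_preimage coors (~` A).
Proof. exact: sigma_algebraC. Qed.

Let rV_bigcup (F : _^nat) : (forall i, g_sigma_preimage coors (F i)) ->
  g_sigma_preimage coors (\bigcup_i (F i)).
Proof. exact: sigma_algebra_bigcup. Qed.

HB.instance Definition _ := @isMeasurable.Build (measure_rV_display d)
  'rV[T]_n (g_sigma_preimage coors) rV_set0 rV_setC rV_bigcup.

End measurable_rV.

Section euclidean.
Context {R : realType}.

(* The library norm on matrices is the sup norm, hence an explicit one here. *)
Definition enorm n (x : 'rV[R]_n) : R := Num.sqrt (\sum_(i < n) x ord0 i ^+ 2).

Definition unit_ball n : set 'rV[R]_n :=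
  [set x | \sum_(i < n) x ord0 i ^+ 2 <= 1].

Definition unit_sphere n : set 'rV[R]_n :=
  [set x | \sum_(i < n) x ord0 i ^+ 2 = 1].

(* n-dimensional Lebesgue measure as the iterated product of the
   one-dimensional one: the successor case is [product_measure1] (the measure
   behind [\x]) with R * R^n identified with R^(1 + n). It is meant to be
   applied to Borel sets only. *)
Fixpoint lebesgue_rV n : set 'rV[R]_n -> \bar R :=
  match n with
  | 0 => fun A => \d_(0 : 'rV[R]_0) A
  | n'.+1 => fun A : set 'rV[R]_(1 + n') =>
      (\int[lebesgue_measure]_x
         lebesgue_rV [set y : 'rV[R]_n' | A (row_mx x%:M y)])%E
  end.

Definition diam n (A : set 'rV[R]_n) : \bar R :=
  ereal_sup [set (enorm (x.1 - x.2))%:E | x in A `*` A].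

(* [diam set0 = -oo] and [x ^+ 0 = 1], hence the case of [set0]: with d = 0
   the Hausdorff measure is the counting measure. *)
Definition diam_pow d n (A : set 'rV[R]_n) : \bar R :=
  (if `[< A = set0 >] then 0 else diam A ^+ d)%E.

(* d-dimensional Hausdorff measure on R^n, for the Euclidean distance and
   without the usual multiplicative constant. *)
Definition hausdorff d n (A : set 'rV[R]_n) : \bar R :=
  ereal_sup [set ereal_inf [set (\sum_(0 <= j <oo) diam_pow d (F j))%E
      | F in [set F : (set 'rV[R]_n)^nat |
          A `<=` \bigcup_j F j /\ forall j, (diam (F j) <= delta%:E)%E]]
    | delta in [set delta : R | 0 < delta]].

Definition convex_hull n (A : set 'rV[R]_n) : set 'rV[R]_n :=
  smallest (fun C => convex_set (C : set (convex_lmodType 'rV[R]_n))) A.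

Definition symmetric_convex_hull k n (x : 'I_k -> 'rV[R]_n) : set 'rV[R]_n :=
  convex_hull [set y | exists i, y = x i \/ y = - x i].

(* k-dimensional volume of a set C contained in a k-dimensional linear
   subspace E of R^n: the Lebesgue measure of C read in the coordinates given
   by an orthonormal basis of E (the rows of U). By the orthogonal invariance
   of the Lebesgue measure it does not depend on the basis, and if C lies in
   several such E all the values are 0; the infimum is that common value. *)
Definition volume k n (C : set 'rV[R]_n) : \bar R :=
  ereal_inf [set lebesgue_rV [set y : 'rV[R]_k | C (y *m U)]
    | U in [set U : 'M[R]_(k, n) |
        U *m U^T = 1%:M /\ forall x, C x -> (x <= U)%MS]].

Definition Gamma (x : R) : R :=
  \int[lebesgue_measure]_(t in `]0, +oo[) (t `^ (x - 1) * expR (- t)).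

End euclidean.

Section random_points.
Context {R : realType} {d} {Omega : measurableType d} (P : probability Omega R).

Definition mutually_independent d' (T : measurableType d') (I : finType)
    (X : I -> {RV P >-> T}) : Prop :=
  forall (J : {set I}) (A : I -> set T), (forall i, measurable (A i)) ->
    P (\bigcap_(i in [set` J]) (X i @^-1` A i)) =
    (\prod_(i in J) P (X i @^-1` A i))%E.

(* The law of X is the measure mu restricted to C and normalized. *)
Definition uniformly_distributed d' (T : measurableType d')
    (mu : set T -> \bar R) (C : set T) (X : {RV P >-> T}) : Prop :=
  forall A, measurable A -> distribution P X A = (mu (A `&` C) / mu C)%E.

Definition uniform_in_ball n (X : {RV P >-> 'rV[R]_n}) : Prop :=
  uniformly_distributed (@lebesgue_rV R n) (@unit_ball R n) X.

(* The surface measure on the sphere is the restriction of the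
   (n-1)-dimensional Hausdorff measure, up to a constant that cancels here. *)
Definition uniform_on_sphere n (X : {RV P >-> 'rV[R]_n}) : Prop :=
  uniformly_distributed (@hausdorff R n.-1 n) (@unit_sphere R n) X.

End random_points.

(* Main.v *)
From HB Require Import structures.
Require Import Defs.
From mathcomp Require Import all_boot all_order all_algebra.
From mathcomp Require Import all_classical all_reals all_analysis.
From mathcomp Require Import measurable_realfun ring.

(** Let [X] be the matrix whose rows are the random points. The symmetric convex
    hull is the image by [X] of the cross-polytope, whose volume is [2^k / k!],
    so that its volume is [2^k / k!] times the square root of the Gram
    determinant [gram X] of [X X^T] ([volume_hull]). This rests on the linear
    change of variables for the iterated Lebesgue measure ([lebn_scale]).

    It remains to integrate [gram X ^ (p / 2)] against the product of the laws
    of the points ([integral_independent]). All that matters about these laws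
    is that they are rotation invariant, and the moment of order [p] of the
    norm: [1] on the sphere, [n / (n + p)] on the ball. Indeed a rotation brings
    the first point to the first axis without changing the law of the others,
    and then the Gram determinant is its squared norm times the Gram determinant
    of the projections of the other points on a space of dimension [n - 1]
    ([gram_momentS]). The projections are again independent and rotation
    invariant, and the computation goes on by induction ([gram_momentE]).

    The induction requires the norm moments of projected laws. They come from a
    comparison with the weight [expR (- |y| ^ 2)] ([norm_moment_tail_gauss]):
    integrate the [p]-th power of the area of the parallelogram spanned by [x]
    and [y], for a rotation invariant law in [x] and this weight in [y]. By
    Tonelli the order of integration does not matter; one order gives the norm
    moment of [x] times the projected moment of the weight, the other gives the
    projected moment of [x] times the norm moment of the weight. So every
    rotation invariant law has its norm moment multiplied, under projection, by
    the same ratio as the weight, whose coordinates are independent.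

    The explicit constants all come from one principle: if [w] and [N] are
    homogeneous, the integral of [w (x) expR (- N x)] over [R^n] is a value of
    Gamma times the integral of [w] over [N <= 1] ([integral_homogeneous_expR]).
    It yields the volume of the cross-polytope ([N] the sum of absolute values),
    the volume of the ball and the Gaussian moments ([N] the squared norm). *)

Set Implicit Arguments.
Unset Strict Implicit.
Unset Printing Implicit Defensive.

Import Order.TTheory GRing.Theory Num.Theory.
Import numFieldNormedType.Exports.

Local Open Scope classical_set_scope.
Local Open Scope ring_scope.

(** * Product measures on row vectors *)

Section rV_measurability.
Context {d1 d2} {T1 : measurableType d1} {T : measurableType d2}.

Lemma measurable_fun_rVP n (f : T1 -> 'rV[T]_n) :
  (forall i, measurable_fun setT (fun x => f x ord0 i)) <-> measurable_fun setT f.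
Proof.
split=> [mf|mf i]; last first.
  move=> _ Y mY; rewrite setTI.
  rewrite [X in measurable X](_ : _ = f @^-1` [set x | Y (x ord0 i)])//.
  rewrite -[X in measurable X]setTI; apply: mf => //.
  apply: sub_sigma_algebra; rewrite -bigcup_seq /=.
  by exists i => /=; [rewrite mem_index_enum|exists Y; rewrite ?setTI].
pose G := \big[setU/set0]_(i < n)
  preimage_set_system setT (fun x : 'rV[T]_n => x ord0 i) measurable.
apply: (@measurability _ _ _ _ _ _ G) => // _ [B + <-].
rewrite /G -bigcup_seq /= => -[i _ [C mC <-]].
by rewrite !setTI -comp_preimage -[X in measurable X]setTI; exact: mf.
Qed.

End rV_measurability.

Lemma measurable_coord d (T : measurableType d) n (i : 'I_n) :
  measurable_fun setT (fun x : 'rV[T]_n => x ord0 i).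
Proof.
have [_] := @measurable_fun_rVP _ _ _ _ n (@id 'rV[T]_n).
by apply; exact: measurable_id.
Qed.

(** The identification of [T * T^n] with [T^(1 + n)] behind [lebesgue_rV];
    [const_mx] takes the place of [%:M] because [T] need not be a ring. *)
Definition cons_rV (T : Type) n (z : T * 'rV[T]_n) : 'rV[T]_(1 + n) :=
  row_mx (const_mx z.1) z.2.

Lemma cons_rVl T n (z : T * 'rV[T]_n) i : cons_rV z ord0 (lshift n i) = z.1.
Proof. by rewrite row_mxEl mxE. Qed.

Lemma cons_rVr T n (z : T * 'rV[T]_n) i : cons_rV z ord0 (rshift 1 i) = z.2 ord0 i.
Proof. by rewrite row_mxEr. Qed.

Lemma forall_ord1D n (Q : 'I_(1 + n) -> Prop) :
  Q (lshift n ord0) -> (forall i, Q (rshift 1 i)) -> forall i, Q i.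
Proof.
move=> Q0 Q1 i; case: (splitP i) => j ij.
  by rewrite (_ : i = lshift n ord0)//; apply: val_inj => /=; rewrite ij ord1.
by rewrite (_ : i = rshift 1 j)//; exact: val_inj.
Qed.

Lemma measurable_cons_rV d (T : measurableType d) n :
  measurable_fun setT (@cons_rV T n).
Proof.
apply/measurable_fun_rVP; apply: forall_ord1D => [|i].
  by under eq_fun do rewrite cons_rVl; exact: measurable_fst.
under eq_fun do rewrite cons_rVr.
by apply: (measurableT_comp (@measurable_coord _ T n i)); exact: measurable_snd.
Qed.

Section boxes.
Context {d} {T : measurableType d}.

Definition box n (A : 'I_n -> set T) : set 'rV[T]_n :=
  [set x | forall i, A i (x ord0 i)].

Definition boxes n : set (set 'rV[T]_n) :=
  [set B | exists2 A, (forall i, measurable (A i)) & B = box A].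

Lemma measurable_box n (A : 'I_n -> set T) :
  (forall i, measurable (A i)) -> measurable (box A).
Proof.
move=> mA; rewrite (_ : box A =
    \big[setI/setT]_(i < n) ((fun x : 'rV[T]_n => x ord0 i) @^-1` A i)).
  apply: bigsetI_measurable => i _; rewrite -[X in measurable X]setTI.
  exact: measurable_coord.
apply/seteqP; split=> x; rewrite -bigcap_seq /box /=.
  by move=> Ax i _; exact: Ax.
by move=> Ax i; apply: (Ax i); rewrite /= mem_index_enum.
Qed.

Lemma box_cons n (A : 'I_(1 + n) -> set T) :
  @cons_rV T n @^-1` box A =
  A (lshift n ord0) `*` box (fun i => A (rshift 1 i)).
Proof.
apply/seteqP; split=> -[x y] /=; rewrite /box /=.
  move=> Axy; split=> [|i] /=.
    by have := Axy (lshift n ord0); rewrite cons_rVl.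
  by have := Axy (rshift 1 i); rewrite cons_rVr.
move=> [/= Ax Ay]; apply: forall_ord1D => [|i]; first by rewrite cons_rVl.
by rewrite cons_rVr.
Qed.

Lemma boxes_setI n : setI_closed (@boxes n).
Proof.
move=> _ _ [A mA ->] [B mB ->]; exists (fun i => A i `&` B i).
  by move=> i; exact: measurableI.
by apply/seteqP; split=> x /= => [[Ax Bx] i|AB]; split=> // i; case: (AB i).
Qed.

Lemma measurable_boxesE n : @measurable _ 'rV[T]_n = <<s @boxes n >>.
Proof.
apply/seteqP; split; last first.
  apply: smallest_sub; first exact: sigma_algebra_measurable.
  by move=> _ [A mA ->]; exact: measurable_box.
apply: smallest_sub; first exact: smallest_sigma_algebra.
move=> B; rewrite -bigcup_seq /= => -[i _ [C mC <-]].
apply: sub_sigma_algebra; exists (fun j => if j == i then C else setT).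
  by move=> j; case: ifP.
apply/seteqP; split=> x; rewrite /box /=.
  by move=> [_ Cx] j; case: eqP => [->|].
by move=> /(_ i); rewrite eqxx.
Qed.

End boxes.

Section product.
Context {d} {T : measurableType d} {R : realType}.

(** Boxes are stable under intersection and generate the sigma-algebra. *)
Lemma finite_measure_rV_unique n (m1 m2 : {measure set 'rV[T]_n -> \bar R}) :
  (m1 setT < +oo)%E ->
  (forall A, (forall i, measurable (A i)) -> m1 (box A) = m2 (box A)) ->
  forall A, measurable A -> m1 A = m2 A.
Proof.
move=> moo m12 A mA; apply: (measure_unique (@boxes _ T n) (fun=> setT)) => //.
- exact: measurable_boxesE.
- exact: boxes_setI.
- by move=> _; exists (fun=> setT) => //; apply/seteqP; split.
- exact: bigcup_const.
- by move=> _ [B mB ->]; exact: m12.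
Qed.

Section cons.
Variables (n : nat) (m1 : {sigma_finite_measure set T -> \bar R}).
Variable m2 : {sigma_finite_measure set 'rV[T]_n -> \bar R}.

(** An image measure rather than a measure on pairs, so that the recursion of
    [prod_measure] stays within row vectors. *)
Definition cons_measure : set 'rV[T]_(1 + n) -> \bar R :=
  pushforward (m1 \x m2)%E (@cons_rV T n).

Let mcons : measurable_fun setT (@cons_rV T n) := @measurable_cons_rV _ T n.

Let mu : {measure set 'rV[T]_(1 + n) -> \bar R} :=
  measure_function_pushforward__canonical__measure_function_Measure
    (m1 \x m2)%E mcons.

Let cons_measure0 : cons_measure set0 = 0%E.
Proof. exact: (measure0 mu). Qed.

Let cons_measure_ge0 A : (0 <= cons_measure A)%E.
Proof. exact: (measure_ge0 mu). Qed.

Let cons_measure_sigma_additive : semi_sigma_additive cons_measure.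
Proof. exact: (@measure_semi_sigma_additive _ _ _ mu). Qed.

HB.instance Definition _ := isMeasure.Build _ _ _ cons_measure
  cons_measure0 cons_measure_ge0 cons_measure_sigma_additive.

Let uncons (z : 'rV[T]_(1 + n)) : T * 'rV[T]_n :=
  (z ord0 (lshift n ord0), \row_i z ord0 (rshift 1 i)).

Let muncons : measurable_fun setT uncons.
Proof.
apply: measurable_fun_pair; first exact: measurable_coord.
apply/measurable_fun_rVP => i; under eq_fun do rewrite mxE.
exact: measurable_coord.
Qed.

Let cons_measure_sigma_finite : sigma_finite setT cons_measure.
Proof.
have /sigma_finiteP[F [TF ndF Foo]] := sigma_finiteT m1.
have /sigma_finiteP[G [TG ndG Goo]] := sigma_finiteT m2.
exists (fun k => uncons @^-1` (F k `*` G k)) => [|k].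
  rewrite -preimage_bigcup (_ : \bigcup_k _ = setT) ?preimage_setT//.
  apply/seteqP; split=> // -[x y] _.
  have [j _ Fj] : (\bigcup_k F k) x by rewrite -TF.
  have [k _ Gk] : (\bigcup_k G k) y by rewrite -TG.
  exists (maxn j k) => //; split.
    by move: x Fj; exact/subsetPset/ndF/leq_maxl.
  by move: y Gk; exact/subsetPset/ndG/leq_maxr.
have [[mF Fk] [mG Gk]] := (Foo k, Goo k); split.
  by rewrite -[X in measurable X]setTI; apply: muncons => //; exact: measurableX.
rewrite /cons_measure /pushforward -comp_preimage (_ : uncons \o _ = id).
  by rewrite product_measure1E// lte_mul_pinfty// ge0_fin_numE.
apply/funext => -[x y]; rewrite /uncons /= cons_rVl; congr pair.
by apply/rowP => l; rewrite mxE cons_rVr.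
Qed.

HB.instance Definition _ := Measure_isSigmaFinite.Build _ _ _ cons_measure
  cons_measure_sigma_finite.

Lemma integral_cons_measure (f : 'rV[T]_(1 + n) -> \bar R) :
  measurable_fun [set: 'rV[T]_(1 + n)] f -> (forall x, (0 <= f x)%E) ->
  (\int[cons_measure]_z f z = \int[m1]_x \int[m2]_y f (cons_rV (x, y)))%E.
Proof.
move=> mf f0; rewrite ge0_integral_pushforward// preimage_setT fubini_tonelli1//=.
exact: measurableT_comp mf mcons.
Qed.

End cons.

(** The product of a family of sigma-finite measures; over [T = R] it is the
    Lebesgue measure of [R^n], over [T = 'rV[R]_n] the law of a family of
    independent random points. *)
Fixpoint prod_measure n :
    ('I_n -> {sigma_finite_measure set T -> \bar R}) ->
    {sigma_finite_measure set 'rV[T]_n -> \bar R} :=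
  match n with
  | 0 => fun mu => \d_(const_mx point : 'rV[T]_0)
  | n'.+1 => fun mu : 'I_(1 + n') -> _ =>
      cons_measure (mu (lshift n' ord0)) (prod_measure (fun i => mu (rshift 1 i)))
  end.

Lemma prod_measure_box n (mu : 'I_n -> {sigma_finite_measure set T -> \bar R})
    (A : 'I_n -> set T) : (forall i, measurable (A i)) ->
  prod_measure mu (box A) = (\prod_(i < n) mu i (A i))%E.
Proof.
elim: n mu A => [|n IH] mu A mA.
  rewrite big_ord0 /= diracE mem_set//.
  by move=> [].
rewrite [RHS](@big_split_ord _ _ _ 1 n (fun=> true)) big_ord1 /= /cons_measure.
rewrite /pushforward box_cons.
rewrite product_measure1E ?IH//; exact: measurable_box.
Qed.

Lemma integral_prod_measureS n
    (mu : 'I_(1 + n) -> {sigma_finite_measure set T -> \bar R})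
    (f : 'rV[T]_(1 + n) -> \bar R) :
  measurable_fun [set: 'rV[T]_(1 + n)] f -> (forall x, (0 <= f x)%E) ->
  (\int[prod_measure (mu : 'I_n.+1 -> _)]_z f z = \int[mu (lshift n ord0)]_x
     \int[prod_measure (fun i => mu (rshift 1 i))]_y f (cons_rV (x, y)))%E.
Proof. exact: integral_cons_measure. Qed.

Lemma integral_prod_measure0
    (mu : 'I_0 -> {sigma_finite_measure set T -> \bar R})
    (f : 'rV[T]_0 -> \bar R) :
  measurable_fun setT f -> (\int[prod_measure mu]_z f z = f (const_mx point))%E.
Proof. by move=> mf; rewrite integral_dirac// diracT mul1e. Qed.

End product.

Lemma cons_rV_map T T' (phi : T -> T') n (z : T * 'rV[T]_n) :
  map_mx phi (cons_rV z) = cons_rV (phi z.1, map_mx phi z.2).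
Proof. by rewrite /cons_rV map_row_mx map_const_mx. Qed.

Lemma measurable_map_rV d d' (T : measurableType d) (T' : measurableType d')
    (phi : T -> T') n : measurable_fun setT phi ->
  measurable_fun setT (fun x : 'rV[T]_n => map_mx phi x).
Proof.
move=> mphi; apply/measurable_fun_rVP => i.
under eq_fun do rewrite mxE.
exact: measurableT_comp (measurable_coord i).
Qed.

(** By Tonelli, one coordinate at a time. It serves with [phi] a rotation and
    with [phi] the projection that forgets a coordinate. *)
Lemma integral_prod_measure_map d d' (T : measurableType d)
    (T' : measurableType d') (R : realType) (phi : T -> T') n
    (mu : 'I_n -> {sigma_finite_measure set T -> \bar R})
    (mu' : 'I_n -> {sigma_finite_measure set T' -> \bar R})
    (f : 'rV[T']_n -> \bar R) :
  measurable_fun setT phi ->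
  (forall i A, measurable A -> mu' i A = mu i (phi @^-1` A)) ->
  measurable_fun [set: 'rV[T']_n] f -> (forall x, (0 <= f x)%E) ->
  (\int[prod_measure mu]_x f (map_mx phi x) = \int[prod_measure mu']_x f x)%E.
Proof.
move=> mphi; elim: n mu mu' f => [|n IH] mu mu' f mumu' mf f0.
  rewrite !integral_prod_measure0//.
    by congr f; apply/rowP => -[].
  exact: measurableT_comp mf (measurable_map_rV mphi).
rewrite !integral_prod_measureS//; last first.
  exact: measurableT_comp mf (measurable_map_rV mphi).
have mcurry x : measurable_fun setT (fun y => f (cons_rV (x, y))).
  apply: (measurableT_comp mf); apply: (measurableT_comp (@measurable_cons_rV _ _ _)).
  exact: pair1_measurable.
pose g x := (\int[prod_measure (fun i => mu' (rshift 1 i))]_y f (cons_rV (x, y)))%E.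
rewrite [RHS](_ : _ = \int[pushforward (mu (@lshift 1 n ord0)) phi]_x g x)%E.
  rewrite ge0_integral_pushforward// ?preimage_setT.
  - apply: eq_integral => x _ /=; under eq_integral do rewrite cons_rV_map.
    by apply: (IH _ _ (fun y => f (cons_rV (phi x, y)))) => // i A; exact: mumu'.
  - apply: (measurable_fun_fubini_tonelli_F (fun z => f (cons_rV z))) => //.
    exact: measurableT_comp mf (@measurable_cons_rV _ _ _).
  - by move=> x _; apply: integral_ge0.
pose nu := measure_function_pushforward__canonical__measure_function_Measure
  (mu (@lshift 1 n ord0)) mphi.
by apply: (@eq_measure_integral _ _ _ _ nu) => A mA _; exact: mumu'.
Qed.

(** * Lebesgue measure on the line and on R^n *)

(** Turns an identity between measures of sets into one between integrals;
    [k] is the Jacobian of [phi] in the applications. *)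
Lemma ge0_integral_image_scale d d' (T : measurableType d) (T' : measurableType d')
    (R : realType) (m : {measure set T -> \bar R}) (m' : {measure set T' -> \bar R})
    (phi : T -> T') (k : R) (f : T' -> \bar R) :
  0 <= k -> measurable_fun setT phi ->
  (forall A, measurable A -> (k%:E * m (phi @^-1` A))%E = m' A) ->
  measurable_fun setT f -> (forall x, (0 <= f x)%E) ->
  (k%:E * \int[m]_x f (phi x))%E = (\int[m']_x f x)%E.
Proof.
move=> k0 mphi mm' mf f0.
pose nu := measure_function_pushforward__canonical__measure_function_Measure m mphi.
transitivity (\int[mscale (NngNum k0) nu]_x f x)%E.
  rewrite ge0_integral_mscale//=; congr (_ * _)%E.
  by rewrite /nu [RHS]ge0_integral_pushforward ?preimage_setT.
by apply: eq_measure_integral => A mA _; rewrite -mm'.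
Qed.

Section lebesgue_line.
Context {R : realType}.

(** The carrier of [lebesgue_measure] is [measurableTypeR R], whose display is
    not that of [R]; this is the same set function, as a measure on [R]. *)
Definition leb : set R -> \bar R := @lebesgue_measure R.

Let leb0 : leb set0 = 0%E. Proof. exact: measure0. Qed.

Let leb_ge0 A : (0 <= leb A)%E. Proof. exact: measure_ge0. Qed.

Let leb_sigma_additive : semi_sigma_additive leb.
Proof. exact: (@measure_semi_sigma_additive _ _ _ (@lebesgue_measure R)). Qed.

HB.instance Definition _ := isMeasure.Build _ _ _ leb
  leb0 leb_ge0 leb_sigma_additive.

Let leb_sigma_finite : sigma_finite setT leb.
Proof. exact: (@sigma_finiteT _ _ _ (@lebesgue_measure R)). Qed.

HB.instance Definition _ := Measure_isSigmaFinite.Build _ _ _ leb leb_sigma_finite.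

Lemma integral_leb (f : R -> \bar R) :
  measurable_fun setT f -> (forall x, (0 <= f x)%E) ->
  (\int[leb]_x f x = \int[lebesgue_measure]_x f x)%E.
Proof.
move=> mf f0; have mid : measurable_fun setT (id : measurableTypeR R -> R).
  by move=> _ A mA; rewrite setTI.
rewrite -(@ge0_integral_image_scale _ _ _ _ R lebesgue_measure leb id 1)//.
  by rewrite mul1e.
by move=> A mA; rewrite mul1e.
Qed.

(** Both sides are measures that agree on half-open intervals. *)
Lemma leb_affine (a c : R) (A : set R) : a != 0 -> measurable A ->
  (`|a|%:E * leb ((fun x => (a * x + c)%R) @^-1` A))%E = leb A.
Proof.
move=> a0 mA.
have mphi : measurable_fun setT (fun x : measurableTypeR R => (a * x + c : measurableTypeR R)).
  apply: continuous_measurable_fun => x.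
  by apply: cvgD; [apply: cvgM; [exact: cvg_cst|exact: cvg_id]|exact: cvg_cst].
pose nu := measure_function_pushforward__canonical__measure_function_Measure
  (@lebesgue_measure R) mphi.
have k0 : 0 <= `|a| by [].
pose mu : {measure set (measurableTypeR R) -> \bar R} := mscale (NngNum k0) nu.
apply/esym; apply: (@lebesgue_measure_unique _ mu) => // _ [[u v] _ <-].
transitivity (`|a|%:E *
  lebesgue_measure ((fun x : R => (a * x + c)%R) @^-1` `]u, v]))%E; last by [].
have [a_gt0|a_lt0|a00] := ltgtP 0 a; last by rewrite a00 eqxx in a0.
  rewrite (_ : _ @^-1` _ = `](u - c) / a, (v - c) / a]%classic); last first.
    apply/seteqP; split=> x /=; rewrite !in_itv/=.
      by rewrite ltr_pdivrMr// ler_pdivlMr// ltrBlDr lerBrDr mulrC.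
    by rewrite ltr_pdivrMr// ler_pdivlMr// ltrBlDr lerBrDr mulrC.
  rewrite !lebesgue_measure_itv/= !lte_fin ltr_pM2r ?invr_gt0// ltrD2r.
  case: ifPn => uv; rewrite ?mule0// -!EFinB -EFinM gtr0_norm//.
  by congr EFin; rewrite -mulrBl mulrC divfK//; ring.
rewrite (_ : _ @^-1` _ = `[(v - c) / a, (u - c) / a[%classic); last first.
  apply/seteqP; split=> x /=; rewrite !in_itv/=.
    by rewrite ler_ndivrMr// ltr_ndivlMr// lerBrDr ltrBlDr mulrC => /andP[-> ->].
  by rewrite ler_ndivrMr// ltr_ndivlMr// lerBrDr ltrBlDr mulrC => /andP[-> ->].
rewrite !lebesgue_measure_itv/= !lte_fin ltr_nM2r ?invr_lt0// ltrD2r.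
case: ifPn => uv; rewrite ?mule0// -!EFinB -EFinM ltr0_norm//.
by congr EFin; rewrite -mulrBl mulNr mulrC divfK//; ring.
Qed.

Lemma measurable_affine (a c : R) : measurable_fun setT (fun x : R => a * x + c).
Proof.
by apply: measurable_funD => //; apply: measurable_funM.
Qed.

Lemma integral_leb_affine (a c : R) (f : R -> \bar R) : a != 0 ->
  measurable_fun setT f -> (forall x, (0 <= f x)%E) ->
  (`|a|%:E * \int[leb]_x f (a * x + c)%R)%E = (\int[leb]_x f x)%E.
Proof.
move=> a0 mf f0; apply: ge0_integral_image_scale => //.
  exact: measurable_affine.
by move=> A mA; exact: leb_affine.
Qed.

End lebesgue_line.

Section lebesgue_space.
Context {R : realType}.

(** The set function [lebesgue_rV] is only meant for Borel sets; this is the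
    measure that it coincides with there. *)
Definition lebn n : {sigma_finite_measure set 'rV[R]_n -> \bar R} :=
  prod_measure (fun=> leb).

Lemma integral_lebnS n (f : 'rV[R]_(1 + n) -> \bar R) :
  measurable_fun [set: 'rV[R]_(1 + n)] f -> (forall x, (0 <= f x)%E) ->
  (\int[lebn n.+1]_z f z = \int[leb]_x \int[lebn n]_y f (cons_rV (x, y)))%E.
Proof. exact: integral_prod_measureS. Qed.

Lemma lebesgue_rVE n (A : set 'rV[R]_n) : measurable A -> lebesgue_rV A = lebn n A.
Proof.
elim: n A => [|n IH] A mA.
  by rewrite /= (thinmx0 (const_mx point)).
have mcons : measurable (@cons_rV R n @^-1` A).
  by rewrite -[X in measurable X]setTI; exact: measurable_cons_rV.
have mxA : measurable_fun setT (fun x : R => lebn n (xsection (@cons_rV R n @^-1` A) x)).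
  exact: measurable_fun_xsection.
rewrite [RHS](_ : _ = \int[leb]_x lebn n (xsection (@cons_rV R n @^-1` A) x))%E//.
rewrite integral_leb//; apply: eq_integral => x _.
have E : [set y | A (row_mx x%:M y)] = xsection (@cons_rV R n @^-1` A) x.
  apply/seteqP; split=> y; rewrite /xsection /= inE /= /cons_rV;
    by rewrite (_ : const_mx x = x%:M)//; apply/matrixP => i j; rewrite !mxE !ord1.
by rewrite E; apply: IH; exact: measurable_xsection.
Qed.

End lebesgue_space.

(** * Linear change of variables *)

Section linear_change_of_variables.
Context {R : realType}.

Lemma measurable_fun_cons_rVl n (f : 'rV[R]_(1 + n) -> \bar R) (x : R) :
  measurable_fun setT f -> measurable_fun setT (fun y => f (cons_rV (x, y))).
Proof.
move=> mf; apply: (measurableT_comp mf).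
by apply: (measurableT_comp (@measurable_cons_rV _ _ _)); exact: pair1_measurable.
Qed.

Lemma measurable_sum_coord n (c : 'I_n -> R) :
  measurable_fun setT (fun x : 'rV[R]_n => \sum_(i < n) x ord0 i * c i).
Proof.
apply: measurable_sum => i; apply: measurable_funM => //.
exact: measurable_coord.
Qed.

Lemma measurable_mulmxr m n (M : 'M[R]_(m, n)) :
  measurable_fun setT (fun x : 'rV[R]_m => x *m M).
Proof.
apply/measurable_fun_rVP => i; under eq_fun do rewrite mxE.
exact: measurable_sum_coord.
Qed.

Lemma cons_rVD n (x : R) (y : 'rV[R]_n) (v : 'rV[R]_(1 + n)) :
  cons_rV (x, y) + v = cons_rV (x + v ord0 (@lshift 1 n ord0), y + rsubmx v).
Proof.
rewrite -[v in LHS]hsubmxK /cons_rV add_row_mx /=; congr row_mx.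
by apply/matrixP => i j; rewrite !mxE !ord1.
Qed.

Lemma cons_rV_mul_block n (x : R) (y : 'rV[R]_n) a (b : 'rV[R]_n) (c : 'cV[R]_n)
    (D : 'M[R]_n) :
  cons_rV (x, y) *m block_mx (a%:M : 'M[R]_1) b c D =
  cons_rV (x * a + (y *m c) ord0 ord0, x *: b + y *m D).
Proof.
rewrite /cons_rV mul_row_block /=; congr row_mx.
  rewrite (_ : const_mx x = x%:M) -?scalar_mxM; last first.
    by apply/matrixP => i j; rewrite !mxE !ord1.
  by apply/matrixP => i j; rewrite !ord1 !mxE eqxx mulr1n.
congr (_ + _); rewrite -mul_scalar_mx; congr (_ *m _).
by apply/matrixP => i j; rewrite !mxE !ord1.
Qed.

Lemma integral_lebn_translate n (v : 'rV[R]_n) (f : 'rV[R]_n -> \bar R) :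
  measurable_fun setT f -> (forall x, (0 <= f x)%E) ->
  (\int[lebn n]_x f (x + v)%R = \int[lebn n]_x f x)%E.
Proof.
have mD m (w : 'rV[R]_m) : measurable_fun setT (fun x : 'rV[R]_m => x + w).
  apply/measurable_fun_rVP => i; under eq_fun do rewrite mxE.
  by apply: measurable_funD => //; exact: measurable_coord.
elim: n v f => [|n IH] v f mf f0.
  by apply: eq_integral => x _; congr f; rewrite (thinmx0 x) (thinmx0 v) addr0.
have mg : measurable_fun setT (fun x : 'rV[R]_n.+1 => f (x + v)).
  exact: measurableT_comp mf (mD _ v).
rewrite (integral_lebnS mg (fun x => f0 (x + v))).
rewrite (integral_lebnS mf f0).
transitivity (\int[leb]_x
    \int[lebn n]_y f (cons_rV ((x + v ord0 (@lshift 1 n ord0))%R, y)))%E.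
  apply: eq_integral => x _; under eq_integral do rewrite cons_rVD.
  pose x' := x + v ord0 (@lshift 1 n ord0).
  apply: (IH (rsubmx (v : 'rV_(1 + n))) (fun y => f (cons_rV (x', y)))) => //.
  exact: measurable_fun_cons_rVl.
rewrite -[RHS](@integral_leb_affine _ 1 (v ord0 (@lshift 1 n ord0)))//.
- by rewrite normr1 mul1e; under [RHS]eq_integral do rewrite mul1r.
- apply: (measurable_fun_fubini_tonelli_F (fun z => f (cons_rV z))) => //.
  exact: measurableT_comp mf (@measurable_cons_rV _ _ _).
- by move=> x; exact: integral_ge0.
Qed.

(** The change of variables formula for [M]. Stated for integrals, it passes
    to products of matrices by substituting twice. *)
Definition lebn_scales n (M : 'M[R]_n) := forall f : 'rV[R]_n -> \bar R,
  measurable_fun setT f -> (forall x, (0 <= f x)%E) ->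
  (`|\det M|%:E * \int[lebn n]_x f (x *m M) = \int[lebn n]_x f x)%E.

Lemma lebn_scalesM n (M N : 'M[R]_n) :
  lebn_scales M -> lebn_scales N -> lebn_scales (M *m N).
Proof.
move=> sM sN f mf f0; rewrite det_mulmx normrM EFinM [X in (X * _)%E]muleC -muleA.
under eq_integral do rewrite mulmxA.
rewrite (sM (fun x => f (x *m N))) ?sN//.
exact: measurableT_comp mf (measurable_mulmxr _).
Qed.

(** The first coordinate being fixed, this shear translates the others. *)
Lemma lebn_scales_upper n (b : 'rV[R]_n) :
  lebn_scales (block_mx (1%:M : 'M[R]_1) b 0 1%:M : 'M[R]_n.+1).
Proof.
move=> f mf f0; rewrite (@det_ublock _ 1 n) !det1 mulr1 normr1 mul1e.
have mg : measurable_fun setT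
    (fun x : 'rV[R]_n.+1 => f (x *m (block_mx (1%:M : 'M[R]_1) b 0 1%:M : 'M[R]_n.+1))).
  exact: measurableT_comp mf (measurable_mulmxr _).
rewrite (integral_lebnS mg (fun x => f0 _)).
rewrite (integral_lebnS mf f0).
apply: eq_integral => x _; under eq_integral.
  move=> y _; rewrite cons_rV_mul_block mulmx0 mxE addr0 mulr1 mulmx1 addrC; over.
by apply: (integral_lebn_translate _ (measurable_fun_cons_rVl _ mf)).
Qed.

(** The other coordinates being fixed, this shear translates the first one:
    Tonelli brings the integral over the first coordinate inside. *)
Lemma lebn_scales_lower n (c : 'cV[R]_n) :
  lebn_scales (block_mx (1%:M : 'M[R]_1) 0 c 1%:M : 'M[R]_n.+1).
Proof.
move=> f mf f0; have mg : measurable_fun setT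
    (fun x : 'rV[R]_n.+1 => f (x *m (block_mx (1%:M : 'M[R]_1) 0 c 1%:M : 'M[R]_n.+1))).
  exact: measurableT_comp mf (measurable_mulmxr _).
rewrite (@det_lblock _ 1 n) !det1 mulr1 normr1 mul1e.
rewrite (integral_lebnS mg (fun x => f0 _)) (integral_lebnS mf f0).
rewrite (fubini_tonelli (fun z : R * 'rV[R]_n => f (cons_rV z *m
    (block_mx (1%:M : 'M[R]_1) 0 c 1%:M : 'M[R]_(1 + n)))))//; last first.
  exact: measurableT_comp mg (@measurable_cons_rV _ _ _).
rewrite (fubini_tonelli (fun z : R * 'rV[R]_n => f (cons_rV z))
  (measurableT_comp mf (@measurable_cons_rV _ _ _)) (fun z => f0 (cons_rV z))).
apply: eq_integral => y _; under eq_integral.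
  move=> x _; rewrite cons_rV_mul_block scaler0 add0r mulmx1 mulr1 -[x in x + _]mul1r; over.
rewrite /= -[RHS](@integral_leb_affine _ 1 ((y *m c) ord0 ord0))//.
- by rewrite normr1 mul1e.
- apply: (measurableT_comp mf); apply: (measurableT_comp (@measurable_cons_rV _ _ _)).
  exact: pair2_measurable.
Qed.

Lemma lebn_scales_diag n a (D : 'M[R]_n) : a != 0 -> lebn_scales D ->
  lebn_scales (block_mx (a%:M : 'M[R]_1) 0 0 D : 'M[R]_n.+1).
Proof.
move=> a0 sD f mf f0; have mg : measurable_fun setT
    (fun x : 'rV[R]_n.+1 => f (x *m (block_mx (a%:M : 'M[R]_1) 0 0 D : 'M[R]_n.+1))).
  exact: measurableT_comp mf (measurable_mulmxr _).
rewrite (@det_lblock _ 1 n) det_scalar1 normrM EFinM -muleA.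
rewrite (integral_lebnS mg (fun x => f0 _)) (integral_lebnS mf f0).
have mF : measurable_fun setT (fun x : R => \int[lebn n]_y f (cons_rV (x, y)))%E.
  apply: (measurable_fun_fubini_tonelli_F (fun z => f (cons_rV z))) => //.
  exact: measurableT_comp mf (@measurable_cons_rV _ _ _).
rewrite -[RHS](@integral_leb_affine _ a 0 _ a0 mF); last first.
  by move=> x; exact: integral_ge0.
congr (_ * _)%E; rewrite -ge0_integralZl//=; last 2 first.
- apply: (measurable_fun_fubini_tonelli_F (fun z : R * 'rV[R]_n => f (cons_rV z *m
    (block_mx (a%:M : 'M[R]_1) 0 0 D : 'M[R]_(1 + n))))) => //.
  exact: measurableT_comp mg (@measurable_cons_rV _ _ _).
- by move=> x _; exact: integral_ge0.
apply: eq_integral => x _; rewrite -[RHS]sD//; last exact: measurable_fun_cons_rVl.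
congr (_ * _)%E; apply: eq_integral => y _; rewrite cons_rV_mul_block.
by rewrite mulmx0 mxE scaler0 add0r mulrC.
Qed.

(** Block elimination: a matrix with a nonzero corner is a lower shear times a
    block diagonal matrix times an upper shear. A zero corner is made nonzero
    by adding another row to the first one, which is again an upper shear. *)
Lemma lebn_scales_unit n (M : 'M[R]_n) : M \in unitmx -> lebn_scales M.
Proof.
elim: n M => [|n IH] M uM.
  move=> f mf f0; rewrite det_mx00 normr1 mul1e.
  by apply: eq_integral => x _; congr f; rewrite (thinmx0 x) mul0mx.
(* [S] is the Schur complement of the corner [a]. *)
have main a b c (D : 'M[R]_n) : a != 0 ->
    (block_mx (a%:M : 'M[R]_1) b c D : 'M[R]_n.+1) \in unitmx ->
    lebn_scales (block_mx (a%:M : 'M[R]_1) b c D : 'M[R]_n.+1).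
  move=> a0 uB; pose S := D - a^-1 *: (c *m b).
  have E : block_mx (a%:M : 'M[R]_1) b c D =
      block_mx (1%:M : 'M[R]_1) 0 (a^-1 *: c) 1%:M *m
      (block_mx (a%:M : 'M[R]_1) 0 0 S *m block_mx (1%:M : 'M[R]_1) (a^-1 *: b) 0 1%:M).
    rewrite !mulmx_block !mul1mx !mul0mx !mulmx1 !mulmx0 !add0r !addr0.
    rewrite mul_scalar_mx scalerA divff// scale1r -!scalemxAl mul_mx_scalar.
    by rewrite scalerA mulVf// scale1r /S addrC subrK.
  rewrite E; apply: lebn_scalesM; first exact: lebn_scales_lower.
  apply: lebn_scalesM; last exact: lebn_scales_upper.
  apply: lebn_scales_diag => //; apply: IH.
  move: uB; rewrite unitmxE E !det_mulmx !(@det_lblock _ 1 n) (@det_ublock _ 1 n) !det1 !mul1r !mulr1.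
  by rewrite det_scalar1 unitrM => /andP[].
have Mblock (N : 'M[R]_n.+1) : N = block_mx ((N 0 0)%:M : 'M[R]_1)
    (ursubmx (N : 'M[R]_(1 + n))) (dlsubmx (N : 'M[R]_(1 + n))) (drsubmx (N : 'M[R]_(1 + n))).
  apply: etrans (esym (@submxK _ 1 n 1 n N)) _; congr (block_mx _ _ _ _).
  by apply/matrixP => i j; rewrite !mxE !ord1 mulr1n; congr (N _ _); exact: val_inj.
have main' (N : 'M[R]_n.+1) : N 0 0 != 0 -> N \in unitmx -> lebn_scales N.
  by move=> N0 uN; rewrite (Mblock N); apply: main => //; rewrite -Mblock.
have [M00|] := eqVneq (M 0 0) 0; last by move/main'; exact.
have [i Mi] : exists i : 'I_n, M (rshift 1 i) 0 != 0.
  apply: contrapT => /forallNP M0; move: uM; rewrite unitmxE.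
  rewrite (expand_det_col M 0) big1 ?unitr0// => i _.
  suff -> : M i 0 = 0 by rewrite mul0r.
  move: i; apply: forall_ord1D.
    by rewrite -[RHS]M00; congr (M _ _); exact: val_inj.
  by move=> i; apply/eqP/negPn/negP; exact: M0.
pose e : 'rV[R]_n := delta_mx 0 i.
pose U b : 'M[R]_n.+1 := block_mx (1%:M : 'M[R]_1) b 0 1%:M.
have UK : U (- e) *m U e = 1%:M.
  rewrite /U (@mulmx_block _ 1 n 1 n 1 n) !mul1mx !mul0mx !mulmx1 !mulmx0.
  by rewrite !addr0 add0r subrr -scalar_mx_block.
have detU b : \det (U b) = 1 by rewrite (@det_ublock _ 1 n) !det1 mulr1.
have -> : M = U (- e) *m (U e *m M) by rewrite mulmxA UK mul1mx.
apply: lebn_scalesM; first exact: lebn_scales_upper.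
apply: main'; last by rewrite unitmxE det_mulmx detU mul1r -unitmxE.
have -> : (U e *m M) 0 0 = M (rshift 1 i) 0.
  rewrite mxE (@big_split_ord _ _ _ 1 n) big_ord1 /=.
  have -> : M (@lshift 1 n 0) 0 = 0 by rewrite -[RHS]M00; congr (M _ _); exact: val_inj.
  have Ur j : U e 0 (rshift 1 j) = (j == i)%:R.
    have -> : U e 0 (rshift 1 j) = e 0 j.
      rewrite -(@block_mxEur _ 1 n 1 n 1%:M e 0 1%:M).
      by congr (U e _ _); exact: val_inj.
    by rewrite mxE eqxx.
  rewrite mulr0 add0r (bigD1 i)//= Ur eqxx mul1r big1 ?addr0// => j ji.
  by rewrite Ur (negbTE ji) mul0r.
exact: Mi.
Qed.

Lemma lebn_scale n (M : 'M[R]_n) (A : set 'rV[R]_n) : M \in unitmx -> measurable A ->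
  (`|\det M|%:E * lebn n [set x | A (x *m M)] = lebn n A)%E.
Proof.
move=> uM mA; have mA' : measurable [set x : 'rV[R]_n | A (x *m M)].
  by rewrite -[X in measurable X]setTI; exact: (measurable_mulmxr M).
have indicT (B : set 'rV[R]_n) : measurable B ->
    (\int[lebn n]_x (\1_B x)%:E = lebn n B :> \bar R)%E.
  by move=> mB; rewrite integral_indic ?setIT.
rewrite -(indicT A)// -(indicT _ mA').
apply: (lebn_scales_unit uM (f := fun x => (\1_A x)%:E)) => [|x].
  exact/measurable_EFinP.
by rewrite lee_fin.
Qed.

End linear_change_of_variables.

(** * Orthogonal matrices and Gram determinants *)

Section euclidean_geometry.
Context {R : realType}.

Definition sqnorm n (x : 'rV[R]_n) : R := \sum_(i < n) x ord0 i ^+ 2.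

Lemma sqnorm_ge0 n (x : 'rV[R]_n) : 0 <= sqnorm x.
Proof. by apply: sumr_ge0 => i _; exact: sqr_ge0. Qed.

Lemma mulmx_tr_sqnorm n (x : 'rV[R]_n) : x *m x^T = (sqnorm x)%:M.
Proof.
apply/matrixP => i j; rewrite !ord1 !mxE eqxx mulr1n.
by apply: eq_bigr => l _; rewrite mxE expr2.
Qed.

Lemma sqnorm_eq0 n (x : 'rV[R]_n) : (sqnorm x == 0) = (x == 0).
Proof.
apply/eqP/eqP => [|->]; last by rewrite /sqnorm big1// => i _; rewrite mxE expr0n.
move/eqP; rewrite psumr_eq0 => [/allP x0|i _]; last exact: sqr_ge0.
by apply/rowP => i; rewrite mxE; apply/eqP; rewrite -sqrf_eq0; apply: x0; rewrite mem_index_enum.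
Qed.

Definition orthogonal_mx n (Q : 'M[R]_n) := Q *m Q^T = 1%:M.

Lemma sqnorm_orthogonal n (Q : 'M[R]_n) x : orthogonal_mx Q -> sqnorm (x *m Q) = sqnorm x.
Proof.
move=> QQ; have := mulmx_tr_sqnorm (x *m Q).
rewrite trmx_mul mulmxA -[x *m Q *m _]mulmxA QQ mulmx1 mulmx_tr_sqnorm.
by move=> /matrixP/(_ 0 0); rewrite !mxE !mulr1n.
Qed.

Lemma sqnorm_row_mx n (a : R) (y : 'rV[R]_n) :
  sqnorm (row_mx a%:M y) = a ^+ 2 + sqnorm y.
Proof.
rewrite /sqnorm big_split_ord big_ord1 row_mxEl mxE eqxx mulr1n; congr (_ + _).
by apply: eq_bigr => i _; rewrite row_mxEr.
Qed.

(** [Q] is the Householder reflection that exchanges [x] and [|x| e_1]. *)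
Lemma orthogonal_to_axis n (x : 'rV[R]_(1 + n)) : exists2 Q : 'M[R]_(1 + n),
  orthogonal_mx Q & x *m Q = row_mx (Num.sqrt (sqnorm x))%:M 0.
Proof.
set r := Num.sqrt _; pose e : 'rV[R]_(1 + n) := row_mx r%:M 0.
have r2 : r ^+ 2 = sqnorm x by rewrite sqr_sqrtr ?sqnorm_ge0.
have sqe : sqnorm e = sqnorm x.
  by rewrite sqnorm_row_mx r2 [X in _ + X](_ : _ = 0) ?addr0//; apply/eqP; rewrite sqnorm_eq0.
pose v := x - e.
have [v0|v0] := eqVneq v 0.
  by exists 1%:M; rewrite /orthogonal_mx ?trmx1 ?mulmx1//; apply/eqP; rewrite -subr_eq0; apply/eqP.
have sv : sqnorm v != 0 by rewrite sqnorm_eq0.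
pose Q := 1%:M - (2 / sqnorm v) *: (v^T *m v).
have QT : Q^T = Q by rewrite /Q linearB /= trmx1 linearZ /= trmx_mul trmxK.
exists Q.
  have PP : (v^T *m v) *m (v^T *m v) = sqnorm v *: (v^T *m v).
    by rewrite -mulmxA (mulmxA v) mulmx_tr_sqnorm mul_scalar_mx -scalemxAr.
  rewrite /orthogonal_mx QT /Q mulmxBr mulmx1 mulmxBl mul1mx -scalemxAr -scalemxAl PP.
  rewrite !scalerA -scalerBl -addrA -opprD -scalerDl.
  rewrite [X in X *: (v^T *m v)](_ : _ = 0) ?scale0r ?subr0//.
  by field.
have [a xeT] : exists a, x *m e^T = a%:M by exists ((x *m e^T) 0 0); exact: mx11_scalar.
have exT : e *m x^T = a%:M by rewrite -[LHS]trmxK trmx_mul trmxK xeT tr_scalar_mx.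
have xvT : x *m v^T = (sqnorm x - a)%:M.
  by rewrite linearB /= mulmxBr mulmx_tr_sqnorm xeT -raddfB.
have svE : sqnorm v = 2 * (sqnorm x - a).
  have := mulmx_tr_sqnorm v; rewrite {1}/v mulmxBl xvT.
  rewrite /v linearB /= mulmxBr exT mulmx_tr_sqnorm sqe -!raddfB => /matrixP/(_ 0 0).
  by rewrite !mxE !mulr1n => <-; ring.
rewrite /Q mulmxBr mulmx1 -scalemxAr mulmxA xvT mul_scalar_mx scalerA.
rewrite [X in X *: v](_ : _ = 1); last first.
  by rewrite mulrAC -svE divff.
by rewrite scale1r /v opprB addrC subrK.
Qed.

Lemma orthogonal_tr n (Q : 'M[R]_n) : orthogonal_mx Q -> orthogonal_mx Q^T.
Proof. by move=> QQ; rewrite /orthogonal_mx trmxK; exact: mulmx1C. Qed.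

(** A reflection sends the first row of [X] to the first axis; the induction
    hypothesis deals with the other coordinates of the other rows. *)
Lemma LQ_decomposition k n (X : 'M[R]_(k, n)) : (k <= n)%N ->
  exists U : 'M[R]_(k, n), U *m U^T = 1%:M /\ (X <= U)%MS.
Proof.
elim: k n X => [|k IH] [|n] X//.
  by move=> _; exists 0; split; [apply/matrixP => -[]|rewrite (flatmx0 X) sub0mx].
  by move=> _; exists 0; split; [apply/matrixP => -[]|rewrite (flatmx0 X) sub0mx].
rewrite ltnS => kn.
have [Q QQ xQ] := orthogonal_to_axis (usubmx (X : 'M[R]_(1 + k, 1 + n))).
pose Y : 'M[R]_(1 + k, 1 + n) := X *m Q.
have [U [UU /submxP[Z YU]]] := IH _ (drsubmx Y) kn.
pose U' : 'M[R]_(1 + k, 1 + n) := block_mx 1%:M 0 0 U.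
have QTQ : Q^T *m Q = 1%:M by exact: mulmx1C.
have U'U' : U' *m U'^T = 1%:M.
  rewrite /U' tr_block_mx mulmx_block !trmx0 trmx1 !mulmx0 !mul0mx !mulmx1.
  by rewrite !addr0 !add0r UU -scalar_mx_block.
exists (U' *m Q^T); split.
  by rewrite trmx_mul trmxK mulmxA -[U' *m _ *m _]mulmxA QTQ mulmx1.
have -> : X = Y *m Q^T by rewrite /Y -mulmxA QQ mulmx1.
have ur0 : ursubmx Y = 0 by rewrite /ursubmx -mul_usub_mx xQ row_mxKr.
have YE : Y = block_mx (ulsubmx Y) 0 (dlsubmx Y) Z *m U'.
  rewrite mulmx_block !mulmx1 !mulmx0 !mul0mx !addr0 !add0r -YU.
  by rewrite -[LHS]submxK ur0.
by apply: submxMr; apply/submxP; exists (block_mx (ulsubmx Y) 0 (dlsubmx Y) Z).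
Qed.

Definition gram k n (X : 'M[R]_(k, n)) : R := \det (X *m X^T).

Lemma gram_orthogonal k n (X : 'M[R]_(k, n)) (Q : 'M[R]_n) :
  orthogonal_mx Q -> gram (X *m Q) = gram X.
Proof. by move=> QQ; rewrite /gram trmx_mul mulmxA -[X *m Q *m _]mulmxA QQ mulmx1. Qed.

Lemma gram_span k n (Z : 'M[R]_k) (U : 'M[R]_(k, n)) : U *m U^T = 1%:M ->
  gram (Z *m U) = \det Z ^+ 2.
Proof.
move=> UU; rewrite /gram trmx_mul mulmxA -[Z *m U *m _]mulmxA UU mulmx1.
by rewrite det_mulmx det_tr expr2.
Qed.

Lemma gram_ge0 k n (X : 'M[R]_(k, n)) : (k <= n)%N -> 0 <= gram X.
Proof.
move=> kn; have [U [UU /submxP[Z ->]]] := LQ_decomposition X kn.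
by rewrite gram_span// sqr_ge0.
Qed.

(** Base times height: the first row being on the first axis, the others only
    count through their projections on the orthogonal hyperplane. *)
Lemma gram_block k n (a : R) (c : 'cV[R]_k) (Y : 'M[R]_(k, n)) :
  gram (block_mx (a%:M : 'M[R]_1) 0 c Y) = a ^+ 2 * gram Y.
Proof.
have -> : block_mx (a%:M : 'M[R]_1) 0 c Y =
    block_mx (a%:M : 'M[R]_1) 0 c 1%:M *m block_mx (1%:M : 'M[R]_1) 0 0 Y.
  by rewrite mulmx_block !mulmx1 !mulmx0 !mul0mx !mul1mx !addr0 add0r.
rewrite /gram trmx_mul mulmxA -[X in X *m _]mulmxA det_mulmx det_tr det_mulmx.
rewrite tr_block_mx mulmx_block !trmx0 !trmx1 !mulmx0 !mul0mx !mulmx1 !addr0 !add0r.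
by rewrite !det_lblock !det1 det_scalar1 mulr1 mul1r; ring.
Qed.

End euclidean_geometry.

(** * Two integrals over intervals *)

Section one_dimensional_integrals.
Context {R : realType}.
Notation mu := (@lebesgue_measure R).

Lemma continuous_powR (z x : R) : 0 < x -> {for x, continuous (@powR R ^~ z)}.
Proof.
move=> x0; apply/differentiable_continuous/derivable1_diffP.
by apply: derivable_powR; rewrite in_itv/= x0.
Qed.

Let integral_powR_gt0 (z u a : R) : 0 < u -> u < a ->
  (\int[mu]_(t in `]u, a]) (z * t `^ (z - 1))%:E = (a `^ z - u `^ z)%:E)%E.
Proof.
move=> u0 ua.
rewrite integral_itv_obnd_cbnd; last first.
  apply/measurable_EFinP/measurable_funTS.
  by apply: measurable_funM => //; exact: measurable_powR.
rewrite (@continuous_FTC2 _ _ (@powR R ^~ z))//.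
- apply: continuous_in_subspaceT => x; rewrite inE/= in_itv/= => /andP[ux _].
  apply: cvgM; first exact: cvg_cst.
  by apply: continuous_powR; exact: lt_le_trans ux.
- split.
  + move=> x; rewrite in_itv/= => /andP[ux _]; apply: derivable_powR.
    by rewrite in_itv/= (lt_trans u0).
  + by apply: cvg_at_right_filter; exact: continuous_powR.
  + by apply: cvg_at_left_filter; apply: continuous_powR; exact: lt_trans ua.
- move=> x; rewrite in_itv/= => /andP[ux _]; rewrite powR_derive1//.
  by rewrite in_itv/= (lt_trans u0).
Qed.

(** The integrand is unbounded at [0] when [z < 1], hence the limit. *)
Lemma integral_powR (z u a : R) : 0 < z -> 0 <= u -> u <= a ->
  (\int[mu]_(t in `]u, a]) (z * t `^ (z - 1))%:E = (a `^ z - u `^ z)%:E)%E.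
Proof.
move=> z0; rewrite le_eqVlt => /predU1P[<-|u0]; last first.
  rewrite le_eqVlt => /predU1P[->|]; last exact: integral_powR_gt0.
  by rewrite set_itvoc0 integral_set0 subrr.
rewrite le_eqVlt => /predU1P[<-|a0].
  by rewrite set_itvoc0 integral_set0 subrr.
pose F n : set R := `]a / n.+1%:R, a]%classic.
have FU : \bigcup_n F n = `]0, a]%classic.
  apply/seteqP; split=> x.
    move=> [n _]; rewrite /F /= !in_itv/= => /andP[ax ->]; rewrite andbT.
    by apply: le_lt_trans ax; rewrite divr_ge0// ltW.
  rewrite /= in_itv/= => /andP[x0 xa].
  exists (Num.trunc (a / x)) => //; rewrite /F /= in_itv/= xa andbT.
  by rewrite ltr_pdivrMr// mulrC -ltr_pdivrMr// truncnS_gt.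
have mf D : measurable_fun D (fun t : R => (z * t `^ (z - 1))%:E).
  apply/measurable_EFinP/measurable_funTS.
  by apply: measurable_funM => //; exact: measurable_powR.
have H : (\int[mu]_(t in F n) (z * t `^ (z - 1))%:E)%E @[n --> \oo] -->
    (\int[mu]_(t in \bigcup_n F n) (z * t `^ (z - 1))%:E)%E.
  apply: ge0_nondecreasing_set_cvg_integral.
  - apply/nondecreasing_seqP => n; rewrite subsetEset; apply: subset_itvr.
    by rewrite bnd_simp ler_pM2l// lef_pV2 ?posrE// ler_nat.
  - by move=> n; exact: measurable_itv.
  - by move=> n; exact: mf.
  - by move=> n x _; rewrite lee_fin mulr_ge0 ?powR_ge0// ltW.
move: H; rewrite (_ : (fun n => _) =
    (fun n => (a `^ z - (a / n.+1%:R) `^ z)%:E)) => [H|].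
  rewrite -FU; apply: (cvg_unique _ H) => //; apply: cvg_EFin; first exact: nearW.
  apply: cvgB; first exact: cvg_cst.
  rewrite powR0 ?gt_eqF//.
  have /cvg_at_rightP := @powR_cvg0 R _ z0; apply; split.
    by move=> n; rewrite divr_gt0.
  rewrite -[X in _ --> X](mulr0 a); apply: cvgM; first exact: cvg_cst.
  exact: cvg_harmonic.
apply/funext => -[|n].
  by rewrite /F divr1 set_itvoc0 integral_set0 subrr.
rewrite integral_powR_gt0 ?divr_gt0// ltr_pdivrMr// ltr_pMr//.
by rewrite ltr1n.
Qed.

Lemma integral_expRN (s : R) :
  (\int[mu]_(t in `[s, +oo[) (expR (- t))%:E = (expR (- s))%:E)%E.
Proof.
have dF (x : R) : is_derive x 1 (fun t : R => - expR (- t)) (expR (- x)).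
  by apply: is_derive_eq; rewrite mulrN1 opprK.
have cF : continuous (fun t : R => - expR (- t)).
  move=> x; apply/differentiable_continuous/derivable1_diffP.
  exact: ex_derive.
rewrite (@ge0_continuous_FTC2y _ _ (fun t => - expR (- t)) _ 0).
- by rewrite sub0e -EFinN opprK.
- by move=> x _; exact: expR_ge0.
- apply: continuous_subspaceT => x.
  rewrite (_ : (fun _ => _) = \- (fun t : R => - expR (- t))); last first.
    by apply/funext => t /=; rewrite opprK.
  exact/continuousN/cF.
- by rewrite -oppr0; apply: cvgN; exact: cvgr_expR.
- by move=> x _; exact: ex_derive.
- by apply: cvg_at_right_filter; exact: cF.
- by move=> x _; rewrite derive1E derive_val.
Qed.
End one_dimensional_integrals.

(** * Layer cake *)

Section layer_cake.
Context {R : realType}.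

Lemma measurable_natb d (T : measurableType d) (b : T -> bool) :
  measurable_fun setT b -> measurable_fun setT (fun x => (b x)%:R : R).
Proof.
move=> mb; rewrite (_ : (fun _ => _) = (fun x => if b x then 1 else 0)).
  exact: measurable_fun_ifT.
by apply/funext => x; case: (b x).
Qed.

Lemma integral_leb_itv (i : interval R) (f : R -> R) :
  measurable_fun setT f -> (forall t, t \in i -> 0 <= f t) ->
  (\int[lebesgue_measure]_(t in [set` i]) (f t)%:E =
   \int[leb]_t (f t * (t \in i)%:R)%:E)%E.
Proof.
move=> mf f0; have E : (fun t => (f t * (t \in i)%:R)%:E) =
    (fun t => (f t)%:E) \_ [set` i].
  apply/funext => t; rewrite patchE /=.
  have -> : (t \in [set` i]) = (t \in i) by rewrite mem_setE.
  by case: ifPn => _; rewrite ?mulr1 ?mulr0.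
rewrite [LHS]integral_mkcond integral_leb.
- by apply: eq_integral => t _; exact: (esym (congr1 (@^~ t) E)).
- rewrite [X in measurable_fun _ X]E; apply/(measurable_restrictT _ (measurable_itv i)).
  exact/measurable_funTS/measurable_EFinP.
- move=> t; rewrite lee_fin; case: (boolP (t \in i)) => ti; rewrite ?mulr0//.
  by rewrite mulr1 f0.
Qed.

(** Levels are positive, so that sets of level [t] are dilates of that of
    level [1]. *)
Definition step (u t : R) : R := ((0 < t) && (u <= t))%:R.

Lemma step_ge0 u t : 0 <= step u t. Proof. exact: ler0n. Qed.

Lemma measurable_step d (T : measurableType d) (f g : T -> R) :
  measurable_fun setT f -> measurable_fun setT g ->
  measurable_fun setT (fun x => step (f x) (g x)).
Proof.
move=> mf mg; apply: measurable_natb; apply: measurable_and.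
  exact: measurable_fun_ltr.
exact: measurable_fun_ler.
Qed.

(** When [Phi u] is the integral of [g] over the levels [t] above [u], this is
    Tonelli for the pairs [(x, t)] with [N x <= t]. *)
Lemma layer_cake d (X : measurableType d) (m : {sigma_finite_measure set X -> \bar R})
    (w N : X -> R) (g Phi : R -> R) :
  measurable_fun setT w -> (forall x, 0 <= w x) ->
  measurable_fun setT N -> measurable_fun setT g -> (forall t, 0 <= g t) ->
  (forall x, (\int[leb]_t (g t * step (N x) t)%:E = (Phi (N x))%:E)%E) ->
  (\int[m]_x (w x * Phi (N x))%:E =
   \int[leb]_t ((g t)%:E * \int[m]_x (w x * step (N x) t)%:E))%E.
Proof.
move=> mw w0 mN mg g0 PhiE.
have mstep : measurable_fun setT (fun z : X * R => step (N z.1) z.2).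
  by apply: measurable_step => //; exact: measurableT_comp.
transitivity (\int[m]_x \int[leb]_t (w x * g t * step (N x) t)%:E)%E.
  apply: eq_integral => x _; rewrite EFinM -PhiE -ge0_integralZl_EFin//.
  - by apply: eq_integral => t _; rewrite -EFinM mulrA.
  - by move=> t _; rewrite lee_fin mulr_ge0// step_ge0.
  - apply/measurable_EFinP; apply: measurable_funM => //.
    exact: measurable_step.
rewrite (fubini_tonelli (fun z : X * R => (w z.1 * g z.2 * step (N z.1) z.2)%:E)).
- apply: eq_integral => t _; rewrite -ge0_integralZl_EFin//.
  + by apply: eq_integral => x _; rewrite -EFinM mulrCA mulrA.
  + by move=> x _; rewrite lee_fin mulr_ge0// step_ge0.
  + apply/measurable_EFinP; apply: measurable_funM => //.
    exact: measurable_step.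
- apply/measurable_EFinP; apply: measurable_funM => //.
  by apply: measurable_funM => //; exact: measurableT_comp.
- by move=> z; rewrite lee_fin !mulr_ge0// step_ge0.
Qed.

Lemma integral_step_expR (u : R) : 0 <= u ->
  (\int[leb]_t (expR (- t) * step u t)%:E = (expR (- u))%:E)%E.
Proof.
move=> u0; have mexp : measurable_fun setT (fun t : R => expR (- t)).
  by apply: measurableT_comp => //; exact: measurable_oppr.
rewrite -integral_expRN; move: u0; rewrite le_eqVlt => /predU1P[<-|u0].
  rewrite -integral_itv_obnd_cbnd; last exact/measurable_EFinP/measurable_funTS.
  rewrite integral_leb_itv//.
  apply: eq_integral => t _; rewrite in_itv/= andbT /step.
  by case: ltP => //= /ltW ->.
rewrite integral_leb_itv//.
apply: eq_integral => t _; rewrite in_itv/= andbT /step.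
by case: (leP u t) => [ut|]; rewrite ?andbF// (lt_le_trans u0 ut).
Qed.

Lemma integral_step_powR (z u a : R) : 0 < z -> 0 <= u -> 0 <= a ->
  (\int[leb]_t (z * t `^ (z - 1) * (t <= a)%R%:R * step u t)%:E =
   (if (u <= a)%R then a `^ z - u `^ z else 0)%:E)%E.
Proof.
move=> z0 u0 a0.
have mf : measurable_fun setT (fun t : R => z * t `^ (z - 1)).
  by apply: measurable_funM => //; exact: measurable_powR.
have f0 (t : R) : 0 <= z * t `^ (z - 1) by rewrite mulr_ge0 ?powR_ge0// ltW.
case: leP => [ua|au]; last first.
  rewrite integral0_eq// => t _; rewrite /step.
  case: (leP t a) => [ta|]; last by rewrite mulr0 mul0r.
  by rewrite (leNgt u t) (le_lt_trans ta au) andbF mulr0.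
rewrite -integral_powR//; move: u0; rewrite le_eqVlt => /predU1P[<-|u0].
  rewrite integral_leb_itv//.
  apply: eq_integral => t _; rewrite in_itv/= /step -mulrA -natrM mulnb.
  by case: ltP => [/ltW ->|_] /=; rewrite ?andbF ?andbT.
rewrite integral_itv_obnd_cbnd; last exact/measurable_EFinP/measurable_funTS.
rewrite integral_leb_itv//.
apply: eq_integral => t _; rewrite in_itv/= /step -mulrA -natrM mulnb.
by case: (leP u t) => [ut|_] /=; rewrite ?andbF// (lt_le_trans u0 ut) !andbT.
Qed.

End layer_cake.

(** * The Gamma function *)

Section gamma.
Context {R : realType}.

(** Extended real values, so that the recursion comes before finiteness, and
    finiteness can be deduced from it. *)
Definition eGamma (z : R) : \bar R :=
  (\int[leb]_t (t `^ (z - 1) * expR (- t) * (0 < t)%R%:R)%:E)%E.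

Lemma measurable_expRN : measurable_fun setT (fun t : R => expR (- t)).
Proof. by apply: measurableT_comp => //; exact: measurable_oppr. Qed.

Lemma measurable_pos : measurable_fun setT (fun t : R => (0 < t)%R%:R : R).
Proof. by apply: measurable_natb; exact: measurable_fun_ltr. Qed.

Lemma measurable_gamma_integrand (z : R) :
  measurable_fun setT (fun t : R => (t `^ z * expR (- t) * (0 < t)%R%:R)%:E).
Proof.
apply/measurable_EFinP; apply: measurable_funM; last exact: measurable_pos.
by apply: measurable_funM; [exact: measurable_powR|exact: measurable_expRN].
Qed.

Lemma GammaE (z : R) : Gamma z = fine (eGamma z).
Proof.
rewrite /Gamma /Rintegral integral_leb_itv//.
- by congr fine; apply: eq_integral => t _; rewrite in_itv/= andbT.
- by apply: measurable_funM; [exact: measurable_powR|exact: measurable_expRN].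
- by move=> t _; rewrite mulr_ge0 ?powR_ge0 ?expR_ge0.
Qed.

Lemma eGamma_ge0 (z : R) : (0 <= eGamma z)%E.
Proof.
by apply: integral_ge0 => t _; rewrite lee_fin !mulr_ge0 ?powR_ge0 ?expR_ge0.
Qed.

(** Write [t ^ z] as the integral of [z s ^ (z - 1)] over [0 < s <= t] and
    integrate over [t] first: the layer cake formula for [N s = |s|]. *)
Lemma eGammaS (z : R) : 0 < z -> eGamma (1 + z) = (z%:E * eGamma z)%E.
Proof.
move=> z0; apply/esym; rewrite /eGamma -ge0_integralZl_EFin//; first last.
- exact: ltW.
- exact: measurable_gamma_integrand.
- by move=> t _; rewrite lee_fin !mulr_ge0 ?powR_ge0 ?expR_ge0.
pose w (s : R) := z * s `^ (z - 1) * (0 < s)%R%:R.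
have mw : measurable_fun setT w.
  apply: measurable_funM; last exact: measurable_pos.
  by apply: measurable_funM => //; exact: measurable_powR.
transitivity (\int[leb]_s (w s * expR (- `|s|))%:E)%E.
  apply: eq_integral => s _; rewrite -EFinM /w; congr EFin.
  case: (ltP 0 s) => [s0|_]; last by rewrite !mulr0 mul0r.
  by rewrite gtr0_norm// !mulr1 mulrA.
rewrite (@layer_cake _ _ _ leb w (fun s => `|s|) (fun t => expR (- t)) (fun t => expR (- t)))//.
- apply: eq_integral => t _; rewrite (addrC 1) addrK.
  have [t0|t0] := ltP 0 t; last first.
    rewrite mulr0 integral0_eq ?mule0// => s _.
    by rewrite /step ltNge t0 mulr0.
  rewrite mulr1 mulrC EFinM; congr (_ * _)%E.
  have := @integral_step_powR R z 0 t z0 (lexx _) (ltW t0).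
  rewrite (ltW t0) powR0 ?gt_eqF// subr0 => <-.
  apply: eq_integral => s _; congr EFin; rewrite /w /step t0.
  case: (ltP 0 s) => [s0|_]; rewrite ?mulr0 ?mul0r// mulr1.
  by rewrite gtr0_norm// (ltW s0) mulr1.
- by move=> s; rewrite /w !mulr_ge0 ?powR_ge0// ltW.
- exact: measurable_expRN.
- by move=> s; exact: integral_step_expR.
Qed.

Lemma eGamma1 : eGamma 1 = 1%E.
Proof.
rewrite -[RHS](_ : (expR (- 0))%:E = _)%E; last by rewrite oppr0 expR0.
rewrite -integral_step_expR//; apply: eq_integral => t _; congr EFin.
rewrite subrr powRr0 mul1r /step; case: ltP => //= /ltW -> //.
Qed.

Lemma eGamma_nat n : eGamma (1 + n%:R) = (n`!%:R)%:E.
Proof.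
elim: n => [|n IH]; first by rewrite addr0 eGamma1.
rewrite -[n.+1%:R]nat1r eGammaS; first by rewrite IH -EFinM nat1r -natrM factS.
by rewrite nat1r ltr0n.
Qed.

(** The recursion raises the exponent above [0], where [t ^ z] is at most
    [1 + t ^ N] for an integer [N]; both terms give factorials. *)
Lemma eGamma_lty (z : R) : 0 < z -> (eGamma z < +oo)%E.
Proof.
move=> z0; suff : (z%:E * eGamma z < +oo)%E.
  by have := eGamma_ge0 z; case: (eGamma z) => [r _ _|_|]//; rewrite ?ltry// gt0_muley.
rewrite -eGammaS//; pose N := (Num.trunc z).+1.
apply: (@le_lt_trans _ _ (eGamma 1 + eGamma (1 + N%:R))%E); last first.
  by rewrite eGamma1 eGamma_nat -EFinD ltry.
rewrite /eGamma -ge0_integralD//; first last.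
- exact: measurable_gamma_integrand.
- by move=> t _; rewrite lee_fin !mulr_ge0 ?powR_ge0 ?expR_ge0.
- exact: measurable_gamma_integrand.
- by move=> t _; rewrite lee_fin !mulr_ge0 ?powR_ge0 ?expR_ge0.
apply: ge0_le_integral => //.
- by move=> t _; rewrite lee_fin !mulr_ge0 ?powR_ge0 ?expR_ge0.
- exact: measurable_gamma_integrand.
- by apply: emeasurable_funD; exact: measurable_gamma_integrand.
move=> t _; rewrite -EFinD lee_fin -!mulrDl.
case: (ltP 0 t) => [t0|_]; last by rewrite !mulr0.
rewrite !mulr1 ler_pM2r ?expR_gt0// subrr powRr0 !(addrC 1) !addrK.
have [t1|t1] := leP t 1.
  have : t `^ z <= 1 `^ z by rewrite ge0_ler_powR ?nnegrE// ltW.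
  by rewrite powR1 => /le_trans; apply; rewrite lerDr powR_ge0.
by rewrite -[leLHS]addr0 lerD// ler_powR ?ltW// truncnS_gt.
Qed.

Lemma eGamma_fin (z : R) : 0 < z -> eGamma z = (Gamma z)%:E.
Proof. by move=> z0; rewrite GammaE fineK// ge0_fin_numE ?eGamma_ge0 ?eGamma_lty. Qed.

(** Only [0 < t <= 1] is kept, where [expR (- t)] is at least [expR (- 1)] and
    the integral of [z t ^ (z - 1)] is [1]. *)
Lemma Gamma_gt0 (z : R) : 0 < z -> 0 < Gamma z.
Proof.
move=> z0; rewrite -lte_fin -eGamma_fin//.
suff : ((expR (- 1))%:E <= z%:E * eGamma z)%E.
  rewrite eGamma_fin// -EFinM lee_fin lte_fin => H.
  by rewrite -(pmulr_rgt0 _ z0) (lt_le_trans _ H)// expR_gt0.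
have := @integral_step_powR R z 0 1 z0 (lexx _) ler01.
rewrite ler01 powR1 powR0 ?gt_eqF// subr0 => /(congr1 (fun x => (expR (- 1))%:E * x)%E).
rewrite mule1 => <-; rewrite /eGamma -!ge0_integralZl_EFin//; first last.
- apply/measurable_EFinP; apply: measurable_funM; last exact: measurable_step.
  apply: measurable_funM; last by apply: measurable_natb; exact: measurable_fun_ler.
  by apply: measurable_funM => //; exact: measurable_powR.
- by move=> t _; rewrite lee_fin !mulr_ge0 ?powR_ge0 ?step_ge0// ltW.
- exact: ltW.
- exact: measurable_gamma_integrand.
- by move=> t _; rewrite lee_fin !mulr_ge0 ?powR_ge0 ?expR_ge0.
apply: ge0_le_integral => //.
- by move=> t _; rewrite -EFinM lee_fin !mulr_ge0 ?powR_ge0 ?step_ge0 ?expR_ge0// ltW.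
- apply/measurable_EFinP; apply: measurable_funM => //.
  apply: measurable_funM; last exact: measurable_step.
  apply: measurable_funM; last by apply: measurable_natb; exact: measurable_fun_ler.
  by apply: measurable_funM => //; exact: measurable_powR.
- by apply: emeasurable_funM => //; exact: measurable_gamma_integrand.
move=> t _; rewrite -!EFinM lee_fin /step.
case: (ltP 0 t) => [t0|_]; last by rewrite !mulr0.
rewrite (ltW t0) !mulr1 mulrC -!mulrA ler_pM2l// ler_wpM2l ?powR_ge0//.
case: (leP t 1) => [t1|_]; last by rewrite mul0r expR_ge0.
by rewrite mul1r ler_expR lerN2.
Qed.

Lemma GammaS (z : R) : 0 < z -> Gamma (1 + z) = z * Gamma z.
Proof.
move=> z0; apply: EFin_inj; rewrite EFinM -!eGamma_fin ?eGammaS//.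
by rewrite addr_gt0.
Qed.

End gamma.

(** * Homogeneous functions and moments of the Euclidean norm *)

Lemma ge0_mule_eq (R : realType) (a b : R) (x : \bar R) :
  0 < a -> (0 <= x)%E -> b%:E = (a%:E * x)%E -> x = (b / a)%:E.
Proof.
case: x => [r a0 _|a0 _|//]; last by rewrite gt0_muley.
by rewrite -EFinM => -[->]; congr EFin; rewrite mulrC mulKf// gt_eqF.
Qed.

Section homogeneous_integrals.
Context {R : realType}.
Variables (n : nat) (N w : 'rV[R]_n -> R) (delta q : R).
Hypotheses (mN : measurable_fun setT N) (mw : measurable_fun setT w).
Hypotheses (N0 : forall x, 0 <= N x) (w0 : forall x, 0 <= w x).
Hypothesis delta0 : 0 < delta.
Hypothesis Nhom : forall r x, 0 < r -> N (r *: x) = r `^ delta * N x.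
Hypothesis whom : forall r x, 0 < r -> w (r *: x) = r `^ q * w x.

Definition sublevel (t : R) : \bar R :=
  (\int[lebn n]_x (w x * (N x <= t)%R%:R)%:E)%E.

Let msub t : measurable_fun setT (fun x => (w x * (N x <= t)%R%:R)%:E).
Proof.
apply/measurable_EFinP; apply: measurable_funM => //.
by apply: measurable_natb; exact: measurable_fun_ler.
Qed.

Lemma sublevel_ge0 t : (0 <= sublevel t)%E.
Proof. by apply: integral_ge0 => x _; rewrite lee_fin mulr_ge0. Qed.

(** Change of variables for the dilation of ratio [t ^ (1 / delta)]. *)
Lemma sublevel_scale t : 0 < t ->
  sublevel t = ((t `^ ((n%:R + q) / delta))%:E * sublevel 1)%E.
Proof.
move=> t0; pose r := t `^ delta^-1.
have r0 : 0 < r by exact: powR_gt0.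
have rd : r `^ delta = t by rewrite -powRrM mulVf ?gt_eqF// powRr1 ?ltW.
have ur : (r%:M : 'M[R]_n) \in unitmx by rewrite unitmxE det_scalar unitrX// unitfE gt_eqF.
rewrite {1}/sublevel -(lebn_scales_unit ur)//; last first.
  by move=> x; rewrite lee_fin mulr_ge0.
rewrite det_scalar gtr0_norm ?exprn_gt0//.
have -> : t `^ ((n%:R + q) / delta) = r ^+ n * r `^ q.
  rewrite -powR_mulrn ?ltW// -powRD; last by rewrite (gt_eqF r0) implybT.
  by rewrite /r -powRrM mulrC.
rewrite EFinM -muleA; congr (_ * _)%E.
rewrite /sublevel -ge0_integralZl_EFin ?powR_ge0//; last first.
  by move=> x _; rewrite lee_fin mulr_ge0.
apply: eq_integral => x _; rewrite -EFinM mul_mx_scalar whom// Nhom// rd.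
by rewrite -[X in _ <= X]mulr1 ler_pM2l// mulrA.
Qed.

(** By homogeneity the layer cake formula separates the level from the point:
    only the integral of [w] over [N <= 1] remains. *)
Lemma integral_homogeneous_step (g Phi : R -> R) :
  measurable_fun setT g -> (forall t, 0 <= g t) ->
  (forall u, 0 <= u -> (\int[leb]_t (g t * step u t)%:E = (Phi u)%:E)%E) ->
  (\int[lebn n]_x (w x * Phi (N x))%:E =
   \int[leb]_t (t `^ ((n%:R + q) / delta) * g t * (0 < t)%R%:R)%:E * sublevel 1)%E.
Proof.
move=> mg g0 PhiE.
rewrite (@layer_cake _ _ _ (lebn n) w N g Phi)//; last by move=> x; exact: PhiE.
rewrite -ge0_integralZr; [|exact: measurableT| | |exact: sublevel_ge0].
- apply: eq_integral => t _; case: (ltP 0 t) => [t0|t0]; last first.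
    rewrite mulr0 mul0e integral0_eq ?mule0// => x _.
    by rewrite /step ltNge t0 mulr0.
  rewrite mulr1 mulrC EFinM -muleA -sublevel_scale//; congr (_ * _)%E.
  by apply: eq_integral => x _; rewrite /step t0.
- apply/measurable_EFinP; apply: measurable_funM; last exact: measurable_pos.
  by apply: measurable_funM => //; exact: measurable_powR.
- by move=> t _; rewrite lee_fin !mulr_ge0 ?powR_ge0.
Qed.

Lemma integral_homogeneous_expR :
  (\int[lebn n]_x (w x * expR (- N x))%:E =
   eGamma (1 + (n%:R + q) / delta) * sublevel 1)%E.
Proof.
rewrite (@integral_homogeneous_step (fun t => expR (- t)) (fun t => expR (- t))).
- by rewrite /eGamma (addrC 1) addrK.
- exact: measurable_expRN.
- by move=> t; exact: expR_ge0.
- by move=> u; exact: integral_step_expR.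
Qed.

End homogeneous_integrals.

Section gaussian_integrals.
Context {R : realType}.

Lemma measurable_rsubmx n :
  measurable_fun setT (fun x : 'rV[R]_(1 + n) => rsubmx x : 'rV[R]_n).
Proof.
apply/measurable_fun_rVP => i; under eq_fun do rewrite mxE.
exact: measurable_coord.
Qed.

Lemma measurable_sqnorm n : measurable_fun setT (@sqnorm R n).
Proof.
apply: measurable_sum => i; apply: measurable_funX; exact: measurable_coord.
Qed.

Lemma sqnormZ n (r : R) (x : 'rV[R]_n) : sqnorm (r *: x) = r ^+ 2 * sqnorm x.
Proof.
by rewrite /sqnorm mulr_sumr; apply: eq_bigr => i _; rewrite mxE exprMn.
Qed.

Lemma sqnorm_powR_homogeneous n (q r : R) (x : 'rV[R]_n) : 0 < r ->
  sqnorm (r *: x) `^ (q / 2) = r `^ q * sqnorm x `^ (q / 2).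
Proof.
move=> r0; rewrite sqnormZ powRM ?sqnorm_ge0 ?sqr_ge0//; congr (_ * _).
by rewrite -powR_mulrn ?ltW// -powRrM mulrC divfK ?pnatr_eq0.
Qed.

Lemma measurable_sqnorm_powR n (q : R) :
  measurable_fun setT (fun x : 'rV[R]_n => sqnorm x `^ q).
Proof.
apply: (measurableT_comp (measurable_powR q)); exact: measurable_sqnorm.
Qed.

(** Moments of the Euclidean norm for the weight [exp (- |x| ^ 2)] and for the
    unit ball. *)
Definition gauss_moment n (q : R) : \bar R :=
  (\int[lebn n]_x (sqnorm x `^ (q / 2) * expR (- sqnorm x))%:E)%E.

Definition ball_moment n (q : R) : \bar R :=
  (\int[lebn n]_x (sqnorm x `^ (q / 2) * (sqnorm x <= 1)%R%:R)%:E)%E.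

Lemma ball_moment_ge0 n q : (0 <= ball_moment n q)%E.
Proof. by apply: integral_ge0 => x _; rewrite lee_fin mulr_ge0 ?powR_ge0. Qed.

Let sqnorm_homogeneous n (r : R) (x : 'rV[R]_n) : 0 < r ->
  sqnorm (r *: x) = r `^ 2 * sqnorm x.
Proof. by move=> r0; rewrite sqnormZ powR_mulrn// ltW. Qed.

Lemma gauss_moment_ball n (q : R) :
  gauss_moment n q = (eGamma (1 + (n%:R + q) / 2) * ball_moment n q)%E.
Proof.
apply: integral_homogeneous_expR => //.
- exact: measurable_sqnorm.
- exact: measurable_sqnorm_powR.
- exact: sqnorm_ge0.
- by move=> x; exact: powR_ge0.
- exact: sqnorm_homogeneous.
- by move=> r x r0; exact: sqnorm_powR_homogeneous.
Qed.

(** Both moments of the ball compare through [1 - u ^ z], whose layers are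
    [z t ^ (z - 1)] on [0, 1]. *)
Lemma ball_moment_split n (q : R) : 0 < q ->
  (ball_moment n 0 =
   ball_moment n q + (q / (n%:R + q))%:E * ball_moment n 0)%E.
Proof.
move=> q0; pose z := q / 2; have z0 : 0 < z by rewrite divr_gt0.
pose g (t : R) := z * t `^ (z - 1) * (t <= 1)%R%:R.
pose Phi (u : R) := if u <= 1 then 1 - u `^ z else 0.
have mle : measurable_fun setT (fun x : 'rV[R]_n => (sqnorm x <= 1)%R%:R : R).
  by apply: measurable_natb; apply: measurable_fun_ler => //; exact: measurable_sqnorm.
have mg : measurable_fun setT g.
  apply: measurable_funM; last by apply: measurable_natb; exact: measurable_fun_ler.
  by apply: measurable_funM => //; exact: measurable_powR.
have g0 t : 0 <= g t by rewrite !mulr_ge0 ?powR_ge0// ltW.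
have PhiE u : 0 <= u -> (\int[leb]_t (g t * step u t)%:E = (Phi u)%:E)%E.
  by move=> u0; rewrite integral_step_powR// powR1.
pose w (x : 'rV[R]_n) := sqnorm x `^ (0 / 2).
have mw : measurable_fun setT w by exact: measurable_sqnorm_powR.
have layers : (\int[lebn n]_x (w x * Phi (sqnorm x))%:E =
    (q / (n%:R + q))%:E * ball_moment n 0)%E.
  rewrite (@integral_homogeneous_step R n (@sqnorm R n) w 2 0 _ _ _ _ _ _ _ g)//.
  - congr (_ * _)%E; pose a := n%:R / 2 + z.
    have a0 : 0 < a by rewrite ltr_wpDl// divr_ge0.
    have := @integral_step_powR R a 0 1 a0 (lexx _) ler01.
    rewrite ler01 powR1 powR0 ?gt_eqF// subr0 => powE.
    have -> : q / (n%:R + q) = z / a.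
      by rewrite /a /z -mulrDl -mulf_div divff// mulr1.
    rewrite -[RHS]mule1 -powE -ge0_integralZl_EFin//; first last.
    + by rewrite divr_ge0 ?ltW.
    + apply/measurable_EFinP; apply: measurable_funM; last exact: measurable_step.
      apply: measurable_funM; last by apply: measurable_natb; exact: measurable_fun_ler.
      by apply: measurable_funM => //; exact: measurable_powR.
    + by move=> t _; rewrite lee_fin !mulr_ge0 ?powR_ge0 ?step_ge0// ltW.
    apply: eq_integral => t _; rewrite -EFinM; congr EFin; rewrite /g /step.
    case: (ltP 0 t) => [t0|_]; last by rewrite !mulr0.
    rewrite (ltW t0) !mulr1 !mulrA; congr (_ * _).
    rewrite divfK ?gt_eqF//.
    have -> : t `^ (a - 1) = t `^ ((n%:R + 0) / 2) * t `^ (z - 1).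
      by rewrite -powRD ?(gt_eqF t0) ?implybT// addr0 addrA.
    by rewrite /z; ring.
  - exact: measurable_sqnorm.
  - exact: sqnorm_ge0.
  - by move=> x; exact: powR_ge0.
  - exact: sqnorm_homogeneous.
  - by move=> r x r0; exact: sqnorm_powR_homogeneous.
rewrite -layers /ball_moment -ge0_integralD//.
- apply: eq_integral => x _; rewrite -EFinD; congr EFin.
  rewrite /w mul0r powRr0 !mul1r /Phi; case: leP => _; rewrite ?mulr1 ?mulr0 ?addr0//.
  by rewrite addrC subrK.
- by move=> x _; rewrite lee_fin mulr_ge0 ?powR_ge0.
- apply/measurable_EFinP; apply: measurable_funM => //.
  exact: measurable_sqnorm_powR.
- move=> x _; rewrite lee_fin mulr_ge0 ?powR_ge0// /Phi; case: (leP (sqnorm x) 1) => // x1.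
  rewrite subr_ge0; have : sqnorm x `^ z <= 1 `^ z.
    by rewrite ge0_ler_powR ?nnegrE ?sqnorm_ge0// ltW.
  by rewrite powR1.
- apply/measurable_EFinP; apply: measurable_funM => //.
  rewrite /Phi; apply: measurable_fun_ifT => //.
    by apply: measurable_fun_ler => //; exact: measurable_sqnorm.
  by apply: measurable_funB => //; exact: measurable_sqnorm_powR.
Qed.

Lemma sqnorm_cons n (x : R) (y : 'rV[R]_n) :
  sqnorm (cons_rV (x, y)) = x ^+ 2 + sqnorm y.
Proof.
rewrite -sqnorm_row_mx /cons_rV; congr (sqnorm (row_mx _ _)).
by apply/matrixP => i j; rewrite !mxE !ord1.
Qed.

(** The first coordinate integrates out of the weight [exp (- |x| ^ 2)]. *)
Lemma gauss_moment_proj n (q : R) :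
  (\int[lebn n.+1]_x
     (sqnorm (rsubmx (x : 'rV[R]_(1 + n))) `^ (q / 2) * expR (- sqnorm x))%:E =
   (Num.sqrt pi)%:E * gauss_moment n q)%E.
Proof.
have mnorm m : measurable_fun setT (fun x : 'rV[R]_m => expR (- sqnorm x)).
  exact: measurableT_comp measurable_expRN (@measurable_sqnorm _).
have mtail : measurable_fun setT (fun x : 'rV[R]_(1 + n) => sqnorm (rsubmx x)).
  exact: (measurableT_comp (@measurable_sqnorm n) (@measurable_rsubmx n)).
rewrite integral_lebnS; first last.
- by move=> x; rewrite lee_fin mulr_ge0 ?powR_ge0 ?expR_ge0.
- apply/measurable_EFinP; apply: measurable_funM.
    exact: measurableT_comp (measurable_powR _) mtail.
  exact: mnorm.
have mg : measurable_fun setT (fun x : R => expR (- x ^+ 2)).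
  by apply: (measurableT_comp measurable_expRN); exact: measurable_funX.
transitivity (\int[leb]_x ((expR (- x ^+ 2))%:E * gauss_moment n q))%E.
  apply: eq_integral => x _; rewrite -ge0_integralZl_EFin ?expR_ge0//.
  - apply: eq_integral => y _; rewrite -EFinM sqnorm_cons row_mxKr opprD expRD.
    by rewrite mulrCA.
  - by move=> y _; rewrite lee_fin mulr_ge0 ?powR_ge0 ?expR_ge0.
  - apply/measurable_EFinP; apply: measurable_funM.
      exact: measurable_sqnorm_powR.
    exact: mnorm.
rewrite ge0_integralZr//; first last.
- by apply: integral_ge0 => x _; rewrite lee_fin mulr_ge0 ?powR_ge0 ?expR_ge0.
- exact/measurable_EFinP.
congr (_ * _)%E; rewrite integral_leb//; last exact/measurable_EFinP.
exact: integralT_gauss.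
Qed.

Lemma gauss_moment0 n : gauss_moment n 0 = ((Num.sqrt pi) ^+ n)%:E.
Proof.
have w1 m (x : 'rV[R]_m) : sqnorm x `^ (0 / 2) = 1 by rewrite mul0r powRr0.
elim: n => [|n IH].
  rewrite /gauss_moment integral_prod_measure0; first last.
    apply/measurable_EFinP; apply: measurable_funM.
      exact: measurable_sqnorm_powR.
    exact: measurableT_comp measurable_expRN (@measurable_sqnorm _).
  by rewrite w1 mul1r /sqnorm big_ord0 oppr0 expR0.
rewrite exprS EFinM -IH -gauss_moment_proj; apply: eq_integral => x _.
by rewrite !w1.
Qed.

(** The integral of [expR (- |x| ^ 2)] is [pi ^ (n / 2)] as a product of
    integrals over the line, and [Gamma (1 + n / 2)] times the volume of the
    ball by homogeneity. *)
Lemma ball_volume n :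
  ball_moment n 0 = ((Num.sqrt pi) ^+ n / Gamma (1 + n%:R / 2))%:E.
Proof.
have a0 : 0 < 1 + n%:R / 2 :> R by rewrite ltr_pwDl// divr_ge0.
have := gauss_moment_ball n 0; rewrite gauss_moment0 addr0 eGamma_fin//.
by apply: ge0_mule_eq; [exact: Gamma_gt0|exact: ball_moment_ge0].
Qed.

Lemma ball_momentE n (q : R) : (0 < n)%N -> 0 <= q ->
  ball_moment n q = ((n%:R / (n%:R + q))%:E * ball_moment n 0)%E.
Proof.
move=> n0; rewrite le_eqVlt => /predU1P[<-|q0].
  by rewrite addr0 divff ?mul1e// pnatr_eq0 gt_eqF.
have nq : 0 < n%:R + q by rewrite ltr_wpDl.
have := ball_moment_split n q0; rewrite ball_volume.
have := ball_moment_ge0 n q; case: (ball_moment n q) => [r|_|]//.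
move=> _; rewrite -!EFinM -EFinD; set v := Num.sqrt pi ^+ n / Gamma (1 + n%:R / 2) => -[vE]; congr EFin.
have -> : r = v - q / (n%:R + q) * v by rewrite {1}vE addrK.
by field; rewrite gt_eqF.
Qed.

Lemma gauss_momentE n (q : R) : (0 < n)%N -> 0 <= q ->
  gauss_moment n q =
  ((Num.sqrt pi) ^+ n * (Gamma ((n%:R + q) / 2) / Gamma (n%:R / 2)))%:E.
Proof.
move=> n0 q0; have n0' : 0 < n%:R :> R by rewrite ltr0n.
have nq : 0 < n%:R + q by rewrite ltr_wpDr.
rewrite gauss_moment_ball ball_momentE// ball_volume.
rewrite eGamma_fin; last by rewrite addr_gt0// divr_gt0.
rewrite !GammaS ?divr_gt0// -!EFinM; congr EFin.
have G0 : Gamma (n%:R / 2 : R) != 0 by rewrite gt_eqF ?Gamma_gt0 ?divr_gt0.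
move: (Gamma (n%:R / 2)) G0 (Gamma ((n%:R + q) / 2)) (Num.sqrt pi) => a a0 b c.
by field; rewrite a0 !gt_eqF.
Qed.

End gaussian_integrals.

(** * Volume of the symmetric convex hull *)

Section rotations.
Context {R : realType}.

Lemma orthogonal_unit n (Q : 'M[R]_n) : orthogonal_mx Q -> Q \in unitmx.
Proof. by move=> /mulmx1_unit[]. Qed.

Lemma orthogonal_det n (Q : 'M[R]_n) : orthogonal_mx Q -> `|\det Q| = 1.
Proof.
move=> QQ; have : \det Q ^+ 2 = 1 by rewrite expr2 -{2}det_tr -det_mulmx QQ det1.
by move/eqP; rewrite sqrf_eq1 => /orP[] /eqP ->; rewrite ?normrN normr1.
Qed.

Lemma lebn_orthogonal n (Q : 'M[R]_n) (A : set 'rV[R]_n) :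
  orthogonal_mx Q -> measurable A -> lebn n [set x | A (x *m Q)] = lebn n A.
Proof.
move=> QQ mA; rewrite -[RHS](lebn_scale (orthogonal_unit QQ))//.
by rewrite orthogonal_det// mul1e.
Qed.

(** A rotation moves the hyperplane to [y_0 = 0], a box with a null side. *)
Lemma lebn_hyperplane n (v : 'rV[R]_n) : v != 0 ->
  lebn n [set y | y *m v^T = 0] = 0%E.
Proof.
case: n v => [|n] v v0; first by rewrite (thinmx0 v) eqxx in v0.
have [Q QQ vQ] := orthogonal_to_axis (v : 'rV[R]_(1 + n)).
have r0 : Num.sqrt (sqnorm v) != 0.
  by rewrite sqrtr_eq0 -ltNge lt_neqAle eq_sym sqnorm_eq0 v0 sqnorm_ge0.
pose A (i : 'I_(1 + n)) : set R := if i == 0 then [set 0] else setT.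
have mA i : measurable (A i) by rewrite /A; case: ifP.
have -> : [set y : 'rV[R]_n.+1 | y *m v^T = 0] = [set y | box A (y *m Q)].
  have E (y : 'rV[R]_(1 + n)) : y *m (v : 'rV[R]_(1 + n))^T =
      Num.sqrt (sqnorm v) *: lsubmx (y *m Q).
    have -> : y *m (v : 'rV[R]_(1 + n))^T = (y *m Q) *m (v *m Q)^T.
      by rewrite trmx_mul mulmxA -(mulmxA y) QQ mulmx1.
    rewrite vQ tr_row_mx -[y *m Q in LHS]hsubmxK mul_row_col trmx0 mulmx0 addr0.
    by rewrite tr_scalar_mx mul_mx_scalar.
  apply/seteqP; split=> y; rewrite /= E.
    move=> /eqP; rewrite scaler_eq0 (negbTE r0) => /eqP/matrixP/(_ 0 0).
    rewrite [LHS]mxE [RHS]mxE => yQ0 i; rewrite /A; case: eqP => // ->.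
    by rewrite /= -[RHS]yQ0; congr ((y *m Q) _ _); exact: val_inj.
  move=> /(_ 0); rewrite /A eqxx /= => yQ0; apply/eqP; rewrite scaler_eq0; apply/orP; right.
  apply/eqP/matrixP => i j; rewrite !ord1 [LHS]mxE [RHS]mxE -[RHS]yQ0.
  by congr ((y *m Q) _ _); exact: val_inj.
rewrite lebn_orthogonal//; last exact: measurable_box.
rewrite (@prod_measure_box _ _ _ (1 + n))// (bigD1 ord0)//= /A eqxx.
by rewrite /leb lebesgue_measure_set1 mul0e.
Qed.

End rotations.

Section cross_polytope.
Context {R : realType}.

Definition l1norm n (x : 'rV[R]_n) : R := \sum_(i < n) `|x ord0 i|.

Definition cross_polytope n : set 'rV[R]_n := [set x | l1norm x <= 1].

Lemma measurable_l1norm n : measurable_fun setT (@l1norm n).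
Proof.
apply: measurable_sum => i; apply: (measurableT_comp (@normr_measurable R setT)).
exact: measurable_coord.
Qed.

Lemma l1norm_ge0 n (x : 'rV[R]_n) : 0 <= l1norm x.
Proof. by apply: sumr_ge0 => i _. Qed.

Lemma l1norm_cons n (x : R) (y : 'rV[R]_n) :
  l1norm (cons_rV (x, y)) = `|x| + l1norm y.
Proof.
rewrite /l1norm (@big_split_ord _ _ _ 1 n) big_ord1 cons_rVl; congr (_ + _).
by apply: eq_bigr => i _; rewrite cons_rVr.
Qed.

Lemma integral_expR_norm : (\int[leb]_x (expR (- `|x : R|))%:E = 2%:E)%E.
Proof.
transitivity (\int[leb]_x (1 * expR (- `|x : R|))%:E)%E.
  by apply: eq_integral => x _; rewrite mul1r.
rewrite (@layer_cake _ _ _ leb (fun=> 1) (fun x => `|x|) (fun t => expR (- t))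
  (fun t => expR (- t)))//; first last.
- by move=> x; exact: integral_step_expR.
- exact: measurable_expRN.
transitivity (2%:E * eGamma (1 + 1) : \bar R)%E; last first.
  by rewrite eGammaS// eGamma1 !mule1.
rewrite /eGamma -ge0_integralZl_EFin//; first last.
- exact: measurable_gamma_integrand.
- by move=> t _; rewrite lee_fin !mulr_ge0 ?powR_ge0 ?expR_ge0.
apply: eq_integral => t _; rewrite addrK.
have [t0|t0] := ltP 0 t; last first.
  rewrite mulr0 mule0 integral0_eq ?mule0// => x _.
  by rewrite /step ltNge t0 mulr0.
rewrite powRr1 ?(ltW t0)// mulr1 mulrC EFinM [RHS]muleC -muleA; congr (_ * _)%E.
have := @integral_leb_itv R `[- t, t] (fun=> 1) (measurable_cst _) (fun _ _ => ler01).
rewrite integral_cst//= lebesgue_measure_itv/= lte_fin.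
rewrite ifT; last by rewrite gtrN.
rewrite opprK mul1e -EFinD => E.
rewrite (_ : t%:E * 2%:E = (t + t)%:E)%E; last by rewrite -EFinM -mulr2n mulr_natr.
rewrite E; apply: eq_integral => x _; congr EFin; rewrite /step t0.
by rewrite in_itv/= ler_norml.
Qed.

Lemma integral_expR_l1norm n :
  (\int[lebn n]_x (expR (- l1norm x))%:E = (2 ^+ n)%:E)%E.
Proof.
have ml1 m : measurable_fun setT (fun x : 'rV[R]_m => (expR (- l1norm x))%:E).
  apply/measurable_EFinP; exact: measurableT_comp measurable_expRN (@measurable_l1norm _).
elim: n => [|n IH].
  by rewrite integral_prod_measure0// /l1norm big_ord0 oppr0 expR0.
rewrite integral_lebnS//.
transitivity (\int[leb]_x ((expR (- `|x : R|))%:E * (2 ^+ n)%:E))%E.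
  apply: eq_integral => x _; rewrite -IH -ge0_integralZl_EFin ?expR_ge0//.
    by apply: eq_integral => y _; rewrite -EFinM l1norm_cons opprD expRD.
  exact: ml1.
rewrite ge0_integralZr//.
- by rewrite integral_expR_norm -EFinM exprS.
- apply/measurable_EFinP; apply: (measurableT_comp measurable_expRN).
  exact: normr_measurable.
Qed.

Lemma measurable_cross_polytope n : measurable (@cross_polytope n).
Proof.
have := measurable_fun_ler (@measurable_l1norm n) (measurable_cst (1 : R)).
move=> /(_ measurableT [set true] I); rewrite setTI.
by rewrite (_ : _ @^-1` _ = @cross_polytope n).
Qed.

(** The integral of [expR (- |x|_1)] is [2 ^ n] as a product, and [n!] times
    the volume of the cross-polytope by homogeneity. *)
Lemma lebn_cross_polytope n : lebn n (@cross_polytope n) = (2 ^+ n / n`!%:R)%:E.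
Proof.
have subE : sublevel (@l1norm n) (fun=> 1) 1 = lebn n (@cross_polytope n).
  rewrite -[X in _ = lebn n X]setIT -integral_indic//; last first.
    exact: measurable_cross_polytope.
  apply: eq_integral => x _; rewrite mul1r indicE; congr ((nat_of_bool _)%:R)%:E.
  by apply/idP/idP => [?|/set_mem//]; rewrite inE.
have : (2 ^+ n)%:E = (eGamma (1 + (n%:R + 0) / 1) * lebn n (@cross_polytope n))%E.
  rewrite -subE -integral_homogeneous_expR//.
  - by rewrite -integral_expR_l1norm; apply: eq_integral => x _; rewrite mul1r.
  - exact: measurable_l1norm.
  - exact: l1norm_ge0.
  - move=> r x r0; rewrite powRr1 ?ltW// /l1norm mulr_sumr; apply: eq_bigr => i _.
    by rewrite mxE normrM gtr0_norm.
  - by move=> r x r0; rewrite powRr0 mulr1.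
rewrite addr0 divr1 eGamma_nat.
have n0 : 0 < n`!%:R :> R by rewrite ltr0n fact_gt0.
by apply: ge0_mule_eq => //; exact: measure_ge0.
Qed.

End cross_polytope.

Section volume_of_hull.
Context {R : realType}.

(** The integral of a nonnegative function is the supremum of those of the
    simple functions below it. This makes [lebesgue_rV] monotone on all sets. *)
Lemma ge0_le_integral_nonmeasurable d (T : measurableType d)
    (mu : {measure set T -> \bar R}) (f g : T -> \bar R) :
  (forall x, (0 <= f x)%E) -> (forall x, (f x <= g x)%E) ->
  (\int[mu]_x f x <= \int[mu]_x g x)%E.
Proof.
move=> f0 fg; have g0 x : (0 <= g x)%E by exact: le_trans (fg x).
rewrite !ge0_integralTE//; apply: ereal_sup_le => _ [h hf <-].
by exists h => // x; exact: le_trans (hf x) (fg x).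
Qed.

Lemma lebesgue_rV_ge0 n (A : set 'rV[R]_n) : (0 <= lebesgue_rV A)%E.
Proof.
elim: n A => [|n IH] A; first exact: measure_ge0.
by apply: integral_ge0 => x _; exact: IH.
Qed.

Lemma le_lebesgue_rV n (A B : set 'rV[R]_n) : A `<=` B ->
  (lebesgue_rV A <= lebesgue_rV B)%E.
Proof.
elim: n A B => [|n IH] A B AB.
  rewrite /= !diracE lee_fin ler_nat.
  by case: (boolP (_ \in A)) => // /set_mem/AB/mem_set ->.
apply: ge0_le_integral_nonmeasurable => x; first exact: lebesgue_rV_ge0.
by apply: IH => y; exact: AB.
Qed.

(** An invertible [M] is a change of variables; a singular one maps everything
    into a hyperplane, which is null. *)
Lemma lebesgue_rV_image k (A : set 'rV[R]_k) (M : 'M[R]_k) : measurable A ->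
  (lebn k A < +oo)%E ->
  lebesgue_rV [set y | exists2 c, A c & y = c *m M] = (`|\det M|%:E * lebn k A)%E.
Proof.
move=> mA Aoo; have [uM|] := boolP (M \in unitmx).
  have -> : [set y | exists2 c, A c & y = c *m M] = [set y | A (y *m invmx M)].
    apply/seteqP; split=> y /= => [[c Ac ->]|Ay]; first by rewrite mulmxK.
    by exists (y *m invmx M) => //; rewrite mulmxKV.
  rewrite lebesgue_rVE; last first.
    by rewrite -[X in measurable X]setTI; exact: measurable_mulmxr.
  rewrite -[in RHS](@lebn_scale _ _ (invmx M))// ?unitmx_inv// muleA -EFinM -normrM.
  by rewrite -det_mulmx mulmxV// det1 normr1 mul1e.
rewrite unitmxE unitfE negbK => /eqP dM; rewrite dM normr0 mul0e.
have [v v0 vM] : exists2 v : 'rV[R]_k, v != 0 & v *m M^T = 0.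
  by apply/det0P; rewrite det_tr dM.
have Mv : M *m v^T = 0 by rewrite -[LHS]trmxK trmx_mul trmxK vM trmx0.
apply/eqP; rewrite eq_le lebesgue_rV_ge0 andbT -(lebn_hyperplane v0).
have mH : measurable [set y : 'rV[R]_k | y *m v^T = 0].
  have mf : measurable_fun setT (fun y : 'rV[R]_k => (y *m v^T) ord0 ord0).
    exact: (measurableT_comp (measurable_coord ord0) (measurable_mulmxr v^T)).
  have := mf measurableT [set 0] (measurable_set1 _); rewrite setTI.
  congr measurable; apply/seteqP; split=> y /= => [y0|->]; last by rewrite mxE.
  by apply/matrixP => i j; rewrite !ord1 y0 mxE.
rewrite -lebesgue_rVE//; apply: le_lebesgue_rV => _ [c _ ->] /=.
by rewrite -mulmxA Mv mulmx0.
Qed.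

(** Combinations with [|c|_1 <= 1] form a convex set containing the vertices.
    Conversely, such a combination is built by binary convex combinations that
    split off one vertex [+- x_i] at a time and start from [0], the midpoint of
    two opposite vertices. *)
Lemma symmetric_convex_hullE k n (x : 'I_k -> 'rV[R]_n) : (0 < k)%N ->
  symmetric_convex_hull x =
  [set y | exists2 c, @cross_polytope R k c & y = c *m \matrix_i x i].
Proof.
move=> k0; have mulE c : c *m \matrix_i x i = \sum_(i < k) c ord0 i *: x i.
  rewrite mulmx_sum_row; apply: eq_bigr => i _; by rewrite rowK.
apply/seteqP; split.
  apply: smallest_sub.
    move=> y1 y2 t; rewrite !inE => -[c1 c1l ->] [c2 c2l ->].
    have [u ut [t0 t1]] : exists2 u : R, u = t%:num & 0 <= u /\ 0 <= 1 - u.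
      by exists t%:num => //; rewrite subr_ge0.
    exists (u *: c1 + (1 - u) *: c2); last by rewrite mulmxDl -!scalemxAl ut.
    rewrite /cross_polytope /= in c1l c2l *.

    apply: (@le_trans _ _ (u * l1norm c1 + (1 - u) * l1norm c2)).
      rewrite /l1norm !mulr_sumr -big_split; apply: ler_sum => i _ /=.
      rewrite !mxE (le_trans (ler_normD _ _))// !normrM.
      by rewrite (ger0_norm t0) (ger0_norm t1).
    have : u * l1norm c1 + (1 - u) * l1norm c2 <= u * 1 + (1 - u) * 1.
      by apply: lerD; exact: ler_wpM2l.
    by rewrite !mulr1 subrKC.
  move=> y [i yi]; have del s : `|s| = 1 -> exists2 c, @cross_polytope R k c &
      s *: x i = c *m \matrix_i x i.
    move=> s1; exists (s *: delta_mx 0 i); last by rewrite -scalemxAl -rowE rowK.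
    rewrite /cross_polytope /= /l1norm (bigD1 i)//= big1 => [|j ji].
      by rewrite !mxE !eqxx mulr1 s1 addr0.
    by rewrite !mxE (negbTE ji) andbF mulr0 normr0.
  case: yi => ->; first by rewrite -(scale1r (x i)); apply: del; rewrite normr1.
  by rewrite -scaleN1r; apply: del; rewrite normrN1.
move=> _ [c cl ->]; rewrite mulE => C [Cconv Cx].
have Cconv' (a : R) y z : 0 <= a -> a <= 1 -> C y -> C z -> C (a *: y + (1 - a) *: z).
  move=> a0 a1 /mem_set Cy /mem_set Cz; have := Cconv _ _ (Itv01 a0 a1) Cy Cz.
  by rewrite inE.
have Cpt i (s : R) : `|s| = 1 -> C (s *: x i).
  move=> s1; apply: Cx; exists i; have [s0|s0] := leP 0 s.
    by left; rewrite -[s]ger0_norm// s1 scale1r.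
  by right; rewrite -[s]opprK -(ltr0_norm s0) s1 scaleN1r.
have C0 : C 0.
  pose i0 := Ordinal k0.
  rewrite (_ : 0 = 2^-1 *: (1 *: x i0) + (1 - 2^-1) *: (-1 *: x i0)).
    apply: Cconv'; rewrite ?invr_ge0//; first by rewrite invf_le1// ler1n.
      by apply: Cpt; rewrite normr1.
    by apply: Cpt; rewrite normrN1.
  by rewrite !scalerA -scalerDl (_ : _ + _ = 0) ?scale0r//; field.
have main (s : seq 'I_k) (b : 'I_k -> R) : \sum_(i <- s) `|b i| <= 1 ->
    C (\sum_(i <- s) b i *: x i).
  elim: s b => [|i s IH] b; first by rewrite !big_nil.
  rewrite !big_cons => bs; have sum0 : 0 <= \sum_(j <- s) `|b j|.
    by apply: sumr_ge0 => j _.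
  have bi1 : `|b i| <= 1 by rewrite (le_trans _ bs)// lerDl.
  have [bi0|bi0] := eqVneq (b i) 0.
    by rewrite bi0 scale0r add0r; apply: IH; rewrite (le_trans _ bs)// lerDr.
  have [b1|b1] := eqVneq `|b i| 1.
    have : \sum_(j <- s) `|b j| == 0.
      by move: bs; rewrite b1 gerDl => s0; rewrite eq_le s0.
    rewrite psumr_eq0// => /allP bs0; rewrite big1_seq ?addr0; first exact: Cpt.
    by move=> j /= /bs0/=; rewrite normr_eq0 => /eqP ->; rewrite scale0r.
  have b1' : 0 < 1 - `|b i| by rewrite subr_gt0 lt_neqAle b1.
  have -> : b i *: x i = `|b i| *: ((b i / `|b i|) *: x i).
    by rewrite scalerA mulrC divfK// normr_eq0.
  have -> : \sum_(j <- s) b j *: x j =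
      (1 - `|b i|) *: \sum_(j <- s) (b j / (1 - `|b i|)) *: x j.
    rewrite scaler_sumr; apply: eq_bigr => j _.
    by rewrite scalerA mulrC divfK// gt_eqF.
  apply: Cconv' => //.
    by apply: Cpt; rewrite normrM normfV normr_id divff// normr_eq0.
  apply: IH.
  under eq_bigr do rewrite normrM normfV (gtr0_norm b1').
  by rewrite -mulr_suml ler_pdivrMr// mul1r lerBrDl.
exact: main.
Qed.

(** Read in an orthonormal basis [U], the hull of the rows of [Z *m U] is the
    image of the cross-polytope by [Z], and the Gram determinant of these rows
    is [(\det Z) ^ 2]. *)
Lemma volume_hull k n (x : 'I_k -> 'rV[R]_n) : (0 < k)%N -> (k <= n)%N ->
  volume k (symmetric_convex_hull x) =
  (2 ^+ k / k`!%:R * Num.sqrt (gram (\matrix_i x i)))%:E.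
Proof.
move=> k0 kn; set M := \matrix_i x i; rewrite /volume symmetric_convex_hullE// -/M.
have vertex i : (@cross_polytope R k) (delta_mx 0 i).
  rewrite /cross_polytope /= /l1norm (bigD1 i)//= big1 => [|j ji].
    by rewrite !mxE !eqxx normr1 addr0.
  by rewrite !mxE (negbTE ji) andbF normr0.
rewrite [X in ereal_inf X](_ : _ = [set (2 ^+ k / k`!%:R * Num.sqrt (gram M))%:E]).
  by rewrite ereal_inf1.
have volU (U : 'M[R]_(k, n)) : U *m U^T = 1%:M -> (M <= U)%MS ->
    lebesgue_rV [set y : 'rV[R]_k | exists2 c, (@cross_polytope R k) c & y *m U = c *m M] =
    (2 ^+ k / k`!%:R * Num.sqrt (gram M))%:E.
  move=> UU /submxP[Z ->]; rewrite gram_span// sqrtr_sqr mulrC EFinM.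
  rewrite -lebn_cross_polytope -lebesgue_rV_image.
  - congr lebesgue_rV; apply/seteqP; split=> y /= [c cl yc]; exists c => //.
      have := congr1 (mulmx^~ U^T) yc.
      by rewrite -!mulmxA UU !mulmx1.
    by rewrite yc mulmxA.
  - exact: measurable_cross_polytope.
  - by rewrite lebn_cross_polytope ltry.
apply/seteqP; split=> [_ [U [UU CU] <-]|_ ->].
  apply: volU => //; apply/row_subP => i; apply: CU; exists (delta_mx 0 i) => //.
  by rewrite -rowE.
have [U [UU MU]] := LQ_decomposition M kn.
exists U; last exact: volU.
by split=> // _ [c _ ->]; exact: submx_trans (submxMl _ _) MU.
Qed.

End volume_of_hull.

(** * Rotation invariant laws *)

Section rotation_invariance.
Context {R : realType}.

Definition rotation_invariant n (m : set 'rV[R]_n -> \bar R) :=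
  forall Q, orthogonal_mx Q -> forall A, measurable A ->
    m [set x | A (x *m Q)] = m A.

Lemma integral_rotation n (m : {measure set 'rV[R]_n -> \bar R}) (Q : 'M[R]_n)
    (f : 'rV[R]_n -> \bar R) : rotation_invariant m -> orthogonal_mx Q ->
  measurable_fun setT f -> (forall x, (0 <= f x)%E) ->
  (\int[m]_x f (x *m Q) = \int[m]_x f x)%E.
Proof.
move=> mQ QQ mf f0.
rewrite -[RHS](@ge0_integral_image_scale _ _ _ _ _ m m (fun x => x *m Q) 1)//.
- by rewrite mul1e.
- exact: measurable_mulmxr.
- by move=> A mA; rewrite mul1e -[RHS](mQ Q).
Qed.

Lemma rotation_invariant_lebn n : rotation_invariant (lebn n : set 'rV[R]_n -> \bar R).
Proof. by move=> Q QQ A mA; exact: lebn_orthogonal. Qed.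

Definition norm_moment n (m : set 'rV[R]_n -> \bar R) (p : R) : \bar R :=
  (\int[m]_x (sqnorm x `^ (p / 2))%:E)%E.

Definition tail n (x : 'rV[R]_(1 + n)) : 'rV[R]_n := rsubmx x.

HB.instance Definition _ n := isMeasurableFun.Build _ _ _ _ (@tail n)
  (@measurable_rsubmx R n).

Definition tail_law n (mu : probability 'rV[R]_(1 + n) R) : probability 'rV[R]_n R :=
  distribution mu (@tail n).

Lemma tail_lawE n (mu : probability 'rV[R]_(1 + n) R) A :
  tail_law mu A = mu [set x | A (tail x)].
Proof. by []. Qed.

Lemma norm_moment_tail n (mu : probability 'rV[R]_(1 + n) R) p :
  norm_moment (tail_law mu) p = (\int[mu]_x (sqnorm (tail x) `^ (p / 2))%:E)%E.
Proof.
rewrite /norm_moment ge0_integral_distribution//.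
- apply/measurable_EFinP; exact: measurable_sqnorm_powR.
- by move=> x; rewrite lee_fin powR_ge0.
Qed.

Lemma rotation_invariant_tail n (mu : probability 'rV[R]_(1 + n) R) :
  rotation_invariant mu -> rotation_invariant (tail_law mu).
Proof.
move=> muQ Q QQ A mA; rewrite !tail_lawE.
pose Q' : 'M[R]_(1 + n) := block_mx 1%:M 0 0 Q.
have QQ' : orthogonal_mx Q'.
  rewrite /orthogonal_mx /Q' tr_block_mx mulmx_block !trmx0 trmx1 !mulmx0 !mul0mx.
  by rewrite mulmx1 !addr0 !add0r QQ -scalar_mx_block.
have mA' : measurable [set x : 'rV[R]_(1 + n) | A (tail x)].
  by rewrite -[X in measurable X]setTI; exact: measurable_rsubmx.
rewrite -[RHS](muQ Q')//; congr (mu _); apply/seteqP; split=> x /=;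
  rewrite /tail -[x in rsubmx (x *m _)]hsubmxK mul_row_block row_mxKr;
  by rewrite mulmx0 add0r.
Qed.

(** The squared area of the parallelogram spanned by two vectors: the Gram
    determinant of two rows, in a form that is visibly symmetric. *)
Definition area2 n (x y : 'rV[R]_n) : R :=
  sqnorm x * sqnorm y - (x *m y^T) ord0 ord0 ^+ 2.

Lemma area2C n (x y : 'rV[R]_n) : area2 x y = area2 y x.
Proof.
rewrite /area2 mulrC; congr (_ - _ ^+ 2).
by rewrite -[in LHS](trmxK (x *m y^T)) mxE trmx_mul trmxK.
Qed.

Lemma area2_orthogonal n (x y : 'rV[R]_n) Q : orthogonal_mx Q ->
  area2 (x *m Q) (y *m Q) = area2 x y.
Proof.
move=> QQ; rewrite /area2 !sqnorm_orthogonal//; congr (_ - _ ^+ 2).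
by rewrite trmx_mul mulmxA -(mulmxA x) QQ mulmx1.
Qed.

Lemma area2_axis n (r : R) (y : 'rV[R]_(1 + n)) :
  area2 (row_mx r%:M 0) y = r ^+ 2 * sqnorm (tail y).
Proof.
rewrite /area2 -[y in LHS]hsubmxK /tail.
move: (lsubmx y) (rsubmx y) => a b; rewrite (mx11_scalar a); move: (a 0 0) => {}a.
rewrite !sqnorm_row_mx (_ : sqnorm 0 = 0); last by apply/eqP; rewrite sqnorm_eq0.
rewrite tr_row_mx mul_row_col mul0mx !addr0 tr_scalar_mx -scalar_mxM mxE mulr1n.
by ring.
Qed.

Lemma measurable_area2l n (x : 'rV[R]_n) : measurable_fun setT (area2 x).
Proof.
apply: measurable_funB; first by apply: measurable_funM => //; exact: measurable_sqnorm.
apply: measurable_funX; under eq_fun do rewrite mxE.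
apply: measurable_sum => i; apply: measurable_funM => //.
by under eq_fun do rewrite mxE; exact: measurable_coord.
Qed.

Lemma measurable_area2 n :
  measurable_fun setT (fun z : 'rV[R]_n * 'rV[R]_n => area2 z.1 z.2).
Proof.
have m1 i : measurable_fun setT (fun z : 'rV[R]_n * 'rV[R]_n => z.1 ord0 i).
  exact: measurableT_comp (measurable_coord i) measurable_fst.
have m2 i : measurable_fun setT (fun z : 'rV[R]_n * 'rV[R]_n => z.2 ord0 i).
  exact: measurableT_comp (measurable_coord i) measurable_snd.
apply: measurable_funB.
  apply: measurable_funM.
    exact: measurableT_comp (@measurable_sqnorm R n) measurable_fst.
  exact: measurableT_comp (@measurable_sqnorm R n) measurable_snd.
apply: measurable_funX; under eq_fun do rewrite mxE.
apply: measurable_sum => i; apply: measurable_funM => //.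
by under eq_fun do rewrite mxE; exact: m2.
Qed.

(** Rotate [x] to the first axis; the other vector then only counts through
    its projection. *)
Lemma integral_area2 n (m : {measure set 'rV[R]_(1 + n) -> \bar R})
    (rho : 'rV[R]_(1 + n) -> R) (p : R) x : rotation_invariant m ->
  measurable_fun setT rho -> (forall y, 0 <= rho y) ->
  (forall y Q, orthogonal_mx Q -> rho (y *m Q) = rho y) ->
  (\int[m]_y (area2 x y `^ (p / 2) * rho y)%:E =
   (sqnorm x `^ (p / 2))%:E * \int[m]_y (sqnorm (tail y) `^ (p / 2) * rho y)%:E)%E.
Proof.
move=> mQ mrho rho0 rhoQ; have [Q QQ xQ] := orthogonal_to_axis x.
transitivity (\int[m]_y (area2 (x *m Q) (y *m Q) `^ (p / 2) * rho (y *m Q))%:E)%E.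
  by apply: eq_integral => y _; rewrite area2_orthogonal// rhoQ.
rewrite (integral_rotation (f := fun y => (area2 (x *m Q) y `^ (p / 2) * rho y)%:E))//; first last.
- by move=> y; rewrite lee_fin mulr_ge0 ?powR_ge0.
- apply/measurable_EFinP; apply: measurable_funM => //.
  exact: measurableT_comp (measurable_powR _) (measurable_area2l _).
rewrite -ge0_integralZl_EFin ?powR_ge0//.
- apply: eq_integral => y _; rewrite xQ area2_axis sqr_sqrtr ?sqnorm_ge0//.
  by rewrite powRM ?sqnorm_ge0// -EFinM mulrA.
- by move=> y _; rewrite lee_fin mulr_ge0 ?powR_ge0.
- apply/measurable_EFinP; apply: measurable_funM => //.
  apply: measurableT_comp (measurable_powR _) _.
  exact: measurableT_comp (@measurable_sqnorm R n) (@measurable_rsubmx R n).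
Qed.

(** Both sides are the integral of [area2 x y ^ (p / 2)] for the law [mu] in
    [x] and the weight [expR (- |y| ^ 2)] in [y]: freezing [x] or [y], only the
    norm of the frozen vector matters. *)
Lemma norm_moment_tail_gauss n (mu : probability 'rV[R]_(1 + n) R) (p : R) :
  rotation_invariant mu ->
  (norm_moment (tail_law mu) p * gauss_moment n.+1 p =
   norm_moment mu p * ((Num.sqrt pi)%:E * gauss_moment n p))%E.
Proof.
move=> muQ.
pose h (z : 'rV[R]_(1 + n) * 'rV[R]_(1 + n)) : \bar R :=
  (area2 z.1 z.2 `^ (p / 2) * expR (- sqnorm z.2))%:E.
have mexp : measurable_fun setT (fun x : 'rV[R]_(1 + n) => expR (- sqnorm x)).
  exact: measurableT_comp measurable_expRN (@measurable_sqnorm R _).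
have mh : measurable_fun setT h.
  apply/measurable_EFinP; apply: measurable_funM.
    exact: measurableT_comp (measurable_powR _) (@measurable_area2 _).
  exact: measurableT_comp mexp measurable_snd.
have h0 z : (0 <= h z)%E by rewrite lee_fin mulr_ge0 ?powR_ge0 ?expR_ge0.
have := @fubini_tonelli _ _ _ _ R mu (lebn n.+1) h mh h0.
have -> : (\int[mu]_x \int[lebn n.+1]_y h (x, y) =
    norm_moment mu p * ((Num.sqrt pi)%:E * gauss_moment n p))%E.
  rewrite -gauss_moment_proj /norm_moment -ge0_integralZr//.
  - apply: eq_integral => x _.
    rewrite (@integral_area2 n (lebn n.+1) (fun y => expR (- sqnorm y)))//.
      exact: rotation_invariant_lebn.
    by move=> y Q QQ; rewrite sqnorm_orthogonal.
  - apply/measurable_EFinP; exact: measurable_sqnorm_powR.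
  - by move=> x _; rewrite lee_fin powR_ge0.
  - by apply: integral_ge0 => x _; rewrite lee_fin mulr_ge0 ?powR_ge0 ?expR_ge0.
move=> ->; rewrite muleC norm_moment_tail /gauss_moment -ge0_integralZr//.
- apply: eq_integral => y _.
  transitivity ((expR (- sqnorm y))%:E * \int[mu]_x (area2 y x `^ (p / 2) * 1)%:E)%E.
    rewrite (@integral_area2 n mu (fun=> 1))// [X in (X * _)%E]EFinM muleAC muleC; congr (_ * _)%E.
    by congr (_ * _)%E; apply: eq_integral => x _; rewrite mulr1.
  rewrite -ge0_integralZl_EFin ?expR_ge0//.
  + by apply: eq_integral => x _; rewrite /h /= mulr1 -EFinM mulrC (area2C y).
  + by move=> x _; rewrite lee_fin mulr_ge0 ?powR_ge0.
  + apply/measurable_EFinP; apply: measurable_funM => //.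
    exact: measurableT_comp (measurable_powR _) (measurable_area2l _).
- apply/measurable_EFinP; apply: measurable_funM => //.
  exact: measurable_sqnorm_powR.
- by move=> x _; rewrite lee_fin mulr_ge0 ?powR_ge0 ?expR_ge0.
- by apply: integral_ge0 => x _; rewrite lee_fin powR_ge0.
Qed.

(** [gauss_ratio n p] is the moment of order [p] of the norm for the law with
    density proportional to [exp (- |x| ^ 2)]. *)
Definition gauss_ratio (p : R) n : R := Gamma ((n%:R + p) / 2) / Gamma (n%:R / 2).

Lemma gauss_ratio_gt0 (p : R) n : 0 <= p -> (0 < n)%N -> 0 < gauss_ratio p n.
Proof.
move=> p0 n0; have n0' : 0 < n%:R :> R by rewrite ltr0n.
by rewrite divr_gt0// Gamma_gt0// divr_gt0// ltr_wpDr.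
Qed.

Lemma norm_moment_tailE n (mu : probability 'rV[R]_(1 + n) R) (p : R) :
  rotation_invariant mu -> 0 <= p -> (0 < n)%N ->
  norm_moment (tail_law mu) p =
  (norm_moment mu p * (gauss_ratio p n / gauss_ratio p n.+1)%:E)%E.
Proof.
move=> muQ p0 n0; have := norm_moment_tail_gauss p muQ.
rewrite (gauss_momentE n0 p0) (gauss_momentE (ltn0Sn n) p0).
rewrite -/(gauss_ratio p n) -/(gauss_ratio p n.+1).
have pi0 : 0 < Num.sqrt pi :> R by rewrite sqrtr_gt0 pi_gt0.
have := gauss_ratio_gt0 p0 n0; have := gauss_ratio_gt0 p0 (ltn0Sn n).
move: (gauss_ratio p n) (gauss_ratio p n.+1) (Num.sqrt pi) pi0 => a b c c0 b0 a0.
move: (norm_moment _ p) (norm_moment _ p) => M' M E.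
pose e := c ^+ n.+1 * b; have e0 : e != 0 by rewrite mulf_neq0 ?gt_eqF ?exprn_gt0.
have := congr1 (fun x => x * e^-1%:E)%E E.
rewrite -!muleA -!EFinM -/e divff// mule1 => ->; congr (_ * _%:E)%E.
by rewrite /e exprS; field; rewrite !gt_eqF ?exprn_gt0.
Qed.

End rotation_invariance.

(** * Moments of Gram determinants *)

Section gram_moments.
Context {R : realType}.

Definition mx_of_rows k n (W : 'rV['rV[R]_n]_k) : 'M[R]_(k, n) := \matrix_i W ord0 i.

Lemma measurable_det d (T : measurableType d) k (F : T -> 'M[R]_k) :
  (forall i j, measurable_fun setT (fun t => F t i j)) ->
  measurable_fun setT (fun t => \det (F t)).
Proof.
move=> mF; rewrite /determinant; apply: measurable_sum => s.
apply: measurable_funM => //; apply: measurable_prod => i _; exact: mF.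
Qed.

Lemma measurable_gram k n :
  measurable_fun setT (fun W : 'rV['rV[R]_n]_k => gram (mx_of_rows W)).
Proof.
apply: measurable_det => i j; under eq_fun do rewrite mxE.
apply: measurable_sum => l; under eq_fun do rewrite !mxE.
have mc i' : measurable_fun setT (fun W : 'rV['rV[R]_n]_k => W ord0 i' ord0 l).
  exact: measurableT_comp (measurable_coord l) (measurable_coord i').
by apply: measurable_funM; exact: mc.
Qed.

Lemma measurable_gram_powR k n (p : R) : measurable_fun setT
  (fun W : 'rV['rV[R]_n]_k => (gram (mx_of_rows W) `^ p)%:E).
Proof.
apply/measurable_EFinP; exact: measurableT_comp (measurable_powR p) (@measurable_gram k n).
Qed.

Lemma mx_of_rows_cons k n (x : 'rV[R]_n) (W : 'rV['rV[R]_n]_k) :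
  mx_of_rows (cons_rV (x, W)) = col_mx x (mx_of_rows W).
Proof.
apply/row_matrixP; apply: forall_ord1D => [|i].
  rewrite (@rowKu _ 1 k) rowK cons_rVl; apply/rowP => j.
  by rewrite mxE.
by rewrite (@rowKd _ 1 k) !rowK cons_rVr.
Qed.

Lemma mx_of_rows_mul k n m (W : 'rV['rV[R]_n]_k) (Q : 'M[R]_(n, m)) :
  mx_of_rows (map_mx (mulmx^~ Q) W) = mx_of_rows W *m Q.
Proof. by apply/row_matrixP => i; rewrite row_mul !rowK mxE. Qed.

Lemma mx_of_rows_tail k n (W : 'rV['rV[R]_(1 + n)]_k) :
  mx_of_rows (map_mx (@tail R n) W) = rsubmx (mx_of_rows W).
Proof.
apply/row_matrixP => i; rewrite rowK mxE /tail.
by apply/rowP => j; rewrite !mxE.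
Qed.

Definition gram_moment k n (mu : 'I_k -> probability 'rV[R]_n R) (p : R) : \bar R :=
  (\int[prod_measure (fun i => mu i)]_W (gram (mx_of_rows W) `^ (p / 2))%:E)%E.

(** For each value of the first point, a rotation brings it to the first axis
    without changing the law of the others; the determinant is then its squared
    norm times the Gram determinant of the projections of the others. *)
Lemma gram_momentS k n (mu : 'I_(1 + k) -> probability 'rV[R]_(1 + n) R) (p : R) :
  (k <= n)%N -> (forall i, rotation_invariant (mu i)) ->
  gram_moment mu p = (norm_moment (mu (lshift k ord0)) p *
    gram_moment (fun i => tail_law (mu (rshift 1 i))) p)%E.
Proof.
move=> kn muQ; rewrite /gram_moment.
rewrite integral_prod_measureS; first last.
- by move=> W; rewrite lee_fin powR_ge0.
- exact: measurable_gram_powR.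
rewrite -ge0_integralZr//; first last.
- by apply: integral_ge0 => W _; rewrite lee_fin powR_ge0.
- by move=> x _; rewrite lee_fin powR_ge0.
- apply/measurable_EFinP; exact: measurable_sqnorm_powR.
apply: eq_integral => x _; have [Q QQ xQ] := orthogonal_to_axis x.
pose f (W : 'rV['rV[R]_(1 + n)]_k) := (gram (mx_of_rows (cons_rV (x *m Q, W))) `^ (p / 2))%:E.
have mf : measurable_fun setT f.
  apply: (measurableT_comp (@measurable_gram_powR (1 + k) (1 + n) (p / 2))).
  apply: (measurableT_comp (@measurable_cons_rV _ _ _)).
  exact: pair1_measurable.
have f0 W : (0 <= f W)%E by rewrite lee_fin powR_ge0.
transitivity (\int[prod_measure (fun i => mu (rshift 1 i))]_W f (map_mx (fun y : 'rV[R]_(1 + n) => y *m Q) W))%E.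
  apply: eq_integral => W _; congr (_ `^ _)%:E.
  rewrite -[LHS](gram_orthogonal _ QQ) !mx_of_rows_cons mx_of_rows_mul.
  by rewrite -mul_col_mx.
rewrite (@integral_prod_measure_map _ _ _ _ R (fun y : 'rV[R]_(1 + n) => y *m Q) k _
  (fun i => mu (rshift 1 i)) f)//; first last.
- by move=> i A mA; rewrite -[LHS](muQ _ Q).
- exact: measurable_mulmxr.
rewrite -(@integral_prod_measure_map _ _ _ _ R (@tail R n) k (fun i => mu (rshift 1 i))
  (fun i => tail_law (mu (rshift 1 i))))//; first last.
- by move=> W; rewrite lee_fin powR_ge0.
- exact: measurable_gram_powR.
rewrite -ge0_integralZl_EFin ?powR_ge0//; first last.
- apply: measurableT_comp (@measurable_gram_powR k n (p / 2)) _.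
  exact: measurable_map_rV (@measurable_rsubmx R n).
- by move=> W _; rewrite lee_fin powR_ge0.
apply: eq_integral => W _; rewrite /f -EFinM; congr EFin.
rewrite mx_of_rows_cons mx_of_rows_tail xQ -[mx_of_rows W]hsubmxK.
rewrite -[col_mx _ _]/(block_mx _ _ _ _) gram_block row_mxKr.
by rewrite sqr_sqrtr ?sqnorm_ge0// powRM ?sqnorm_ge0 ?gram_ge0.
Qed.

(** The projected points live in dimension [n - 1] and are again rotation
    invariant; their norm moments are those of the original points up to the
    factor of [norm_moment_tailE], and the factors telescope. *)
Lemma gram_momentE k n (mu : 'I_k -> probability 'rV[R]_n R) (p : R) :
  (k <= n)%N -> 0 <= p -> (forall i, rotation_invariant (mu i)) ->
  gram_moment mu p = (\prod_(i < k) (norm_moment (mu i) p *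
    (gauss_ratio p (n - i) / gauss_ratio p n)%:E))%E.
Proof.
elim: k n mu => [|k IH] n mu kn p0 muQ.
  rewrite big_ord0 /gram_moment integral_prod_measure0; last exact: measurable_gram_powR.
  by rewrite /gram det_mx00 powR1.
case: n mu kn muQ => [//|n] mu kn muQ.
have cn : gauss_ratio p n.+1 != 0 by rewrite gt_eqF// gauss_ratio_gt0.
rewrite (@gram_momentS k n mu p kn muQ) IH//; last first.
  by move=> i; exact: rotation_invariant_tail.
have tailE i : norm_moment (tail_law (mu (rshift 1 i))) p =
    (norm_moment (mu (rshift 1 i)) p * (gauss_ratio p n / gauss_ratio p n.+1)%:E)%E.
  apply: norm_moment_tailE => //.
  exact: leq_trans (leq_ltn_trans (leq0n i) (ltn_ord i)) kn.
have cn' : (0 < n)%N -> gauss_ratio p n != 0.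
  by move=> n0; rewrite gt_eqF// gauss_ratio_gt0.
under eq_bigr do rewrite tailE.
move: (gauss_ratio p) cn cn' => c cn cn'.
rewrite [RHS](@big_split_ord _ _ _ 1 k) big_ord1 subn0 divff// mule1.
congr (_ * _)%E; apply: eq_bigr => i _.
rewrite -muleA -EFinM /= subSS; congr (_ * _%:E)%E.
rewrite mulrC mulrA divfK//; apply: cn'.
exact: leq_trans (leq_ltn_trans (leq0n i) (ltn_ord i)) kn.
Qed.

End gram_moments.

(** * Laws of the random points *)

Section laws.
Context {R : realType}.

Lemma measurable_sqnorm_le n : measurable [set x : 'rV[R]_n | sqnorm x <= 1].
Proof.
have := measurable_fun_ler (@measurable_sqnorm R n) (measurable_cst (1 : R)).
by move=> /(_ measurableT [set true] I); rewrite setTI.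
Qed.

Lemma measurable_unit_sphere n : measurable (@unit_sphere R n).
Proof.
have := @measurable_sqnorm R n measurableT [set 1] (measurable_set1 _).
by rewrite setTI.
Qed.

Lemma diam_orthogonal n (Q : 'M[R]_n) (A : set 'rV[R]_n) : orthogonal_mx Q ->
  diam [set x | A (x *m Q)] = diam A.
Proof.
move=> QQ; have QTQ : Q^T *m Q = 1%:M by exact: mulmx1C.
have enormQ (x : 'rV[R]_n) : enorm (x *m Q) = enorm x.
  by congr Num.sqrt; exact: (sqnorm_orthogonal x QQ).
congr ereal_sup; apply/seteqP; split=> _ [[x y] [/= Ax Ay] <-].
  by exists (x *m Q, y *m Q) => //=; rewrite -mulmxBl enormQ.
exists (x *m Q^T, y *m Q^T) => /=.
  by split; rewrite /= -mulmxA QTQ mulmx1.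
by rewrite -mulmxBl -enormQ -mulmxA QTQ mulmx1.
Qed.

Lemma diam_pow_orthogonal d n (Q : 'M[R]_n) (A : set 'rV[R]_n) : orthogonal_mx Q ->
  diam_pow d [set x | A (x *m Q)] = diam_pow d A.
Proof.
move=> QQ; have QTQ : Q^T *m Q = 1%:M by exact: mulmx1C.
rewrite /diam_pow diam_orthogonal//; congr (if _ then _ else _).
apply: asbool_equiv_eq; split=> [A0|->]; apply/seteqP; split=> // x Ax.
suff : [set x | A (x *m Q)] (x *m Q^T) by rewrite A0.
by rewrite /= -mulmxA QTQ mulmx1.
Qed.

(** An orthogonal map preserves diameters, hence transports coverings. *)
Lemma hausdorff_orthogonal d n (Q : 'M[R]_n) (A : set 'rV[R]_n) : orthogonal_mx Q ->
  hausdorff d [set x | A (x *m Q)] = hausdorff d A.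
Proof.
pose vals (B : set 'rV[R]_n) (delta : R) := [set (\sum_(0 <= j <oo) diam_pow d (F j))%E
  | F in [set F : (set 'rV[R]_n)^nat |
    B `<=` \bigcup_j F j /\ forall j, (diam (F j) <= delta%:E)%E]].
have sub (V : 'M[R]_n) (B : set 'rV[R]_n) delta : orthogonal_mx V ->
    vals B delta `<=` vals [set x | B (x *m V)] delta.
  move=> VV _ [F [BF Fd] <-]; exists (fun j => [set x | F j (x *m V)]).
    split=> [x /BF[j _ Fj]|j]; first by exists j.
    by rewrite diam_orthogonal.
  by apply: eq_eseriesr => j _; rewrite diam_pow_orthogonal.
move=> QQ; rewrite /hausdorff; congr ereal_sup; congr (image _ _).
apply/funext => delta; congr ereal_inf; apply/seteqP; split; last exact: sub.
have QTQ : Q^T *m Q = 1%:M by exact: mulmx1C.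
rewrite -[X in _ `<=` X](_ : vals [set x | A (x *m Q^T *m Q)] delta = _); last first.
  by congr (vals _ delta); apply/seteqP; split=> x /=; rewrite -mulmxA QTQ mulmx1.
exact: (sub Q^T [set x | A (x *m Q)] delta (orthogonal_tr QQ)).
Qed.

Lemma sqnorm_setI_orthogonal n (Q : 'M[R]_n) (A : set 'rV[R]_n) (D : set R) :
  orthogonal_mx Q ->
  [set x | A (x *m Q)] `&` [set x | D (sqnorm x)] =
  [set x | (A `&` [set x | D (sqnorm x)]) (x *m Q)].
Proof.
by move=> QQ; apply/seteqP; split=> x /= []; rewrite sqnorm_orthogonal.
Qed.

Context {d} {Omega : measurableType d} (P : probability Omega R).

Lemma sphere_rotation_invariant n (X : {RV P >-> 'rV[R]_n}) :
  uniform_on_sphere X -> rotation_invariant (distribution P X).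
Proof.
move=> UX Q QQ A mA; rewrite !UX//; last first.
  by rewrite -[X in measurable X]setTI; exact: measurable_mulmxr.
congr (_ / _)%E.
by rewrite (sqnorm_setI_orthogonal A [set 1] QQ) hausdorff_orthogonal.
Qed.

(** The quotient that defines the law has the same value on the sphere as on
    the whole space, where it is [1]: the law is concentrated on the sphere. *)
Lemma sphere_norm_moment n (X : {RV P >-> 'rV[R]_n}) p :
  uniform_on_sphere X -> norm_moment (distribution P X) p = 1%E.
Proof.
move=> UX; have mS := @measurable_unit_sphere n.
have S1 : distribution P X (@unit_sphere R n) = 1%E.
  have <- : distribution P X (setT : set 'rV[R]_n) = 1%E by exact: probability_setT.
  by rewrite (UX _ mS) (UX setT measurableT) setIid setTI.
rewrite /norm_moment.
rewrite (@ge0_ae_eq_integral _ _ _ (distribution P X) setT _ (cst 1%E))//.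
- by rewrite integral_cst// mul1e; exact: probability_setT.
- apply/measurable_EFinP; exact: measurable_sqnorm_powR.
- by move=> x _; rewrite lee_fin powR_ge0.
- exists (~` @unit_sphere R n); split; first exact: measurableC.
    apply: etrans (probability_setC (distribution P X) mS) _.
    by apply: etrans (congr1 (fun z => 1 - z)%E S1) _; rewrite subee.
  apply: subsetC => x Sx _ /=; rewrite /sqnorm.
  by rewrite (Sx : \sum_(i < n) _ = 1) powR1.
Qed.

Lemma uniform_in_ballE n (X : {RV P >-> 'rV[R]_n}) A : uniform_in_ball X ->
  measurable A -> distribution P X A =
  ((fine (ball_moment n 0))^-1%:E * lebn n (A `&` @unit_ball R n))%E.
Proof.
move=> UX mA; have mB := @measurable_sqnorm_le n.
have BE : lebn n (@unit_ball R n) = ball_moment n 0.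
  rewrite -[X in lebn n X]setIT -integral_indic//; apply: eq_integral => x _.
  rewrite mul0r powRr0 mul1r indicE; congr ((nat_of_bool _)%:R)%:E.
  by apply/idP/idP => [/set_mem//|?]; rewrite inE.
rewrite UX// !lebesgue_rVE//; last exact: measurableI.
rewrite BE muleC; congr (_ * _)%E; rewrite ball_volume/= inver ifF//.
apply/negbTE; rewrite gt_eqF// divr_gt0 ?exprn_gt0 ?sqrtr_gt0 ?pi_gt0// Gamma_gt0//.
Qed.

Lemma ball_rotation_invariant n (X : {RV P >-> 'rV[R]_n}) :
  uniform_in_ball X -> rotation_invariant (distribution P X).
Proof.
move=> UX Q QQ A mA; have mB := @measurable_sqnorm_le n.
have mA' : measurable [set x | A (x *m Q)].
  by rewrite -[X in measurable X]setTI; exact: measurable_mulmxr.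
rewrite !(uniform_in_ballE UX)//; congr (_ * _)%E.
rewrite (sqnorm_setI_orthogonal A [set t | t <= 1] QQ) lebn_orthogonal//.
exact: measurableI.
Qed.

Lemma ball_norm_moment n (X : {RV P >-> 'rV[R]_n}) p : (0 < n)%N -> 0 <= p ->
  uniform_in_ball X ->
  norm_moment (distribution P X) p = (n%:R / (n%:R + p))%:E.
Proof.
move=> n0 p0 UX; have mB : measurable (@unit_ball R n) by exact: measurable_sqnorm_le.
pose k : R := (fine (ball_moment n 0))^-1.
have vB : @ball_moment R n 0 = (fine (ball_moment n 0))%:E by rewrite ball_volume.
have B0 : 0 < fine (@ball_moment R n 0).
  by rewrite ball_volume/= divr_gt0 ?exprn_gt0 ?sqrtr_gt0 ?pi_gt0// Gamma_gt0.
have k0 : 0 <= k by rewrite invr_ge0 ltW.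
have mf : measurable_fun setT (fun x : 'rV[R]_n => (sqnorm x `^ (p / 2))%:E).
  by apply/measurable_EFinP; exact: measurable_sqnorm_powR.
have f0 (x : 'rV[R]_n) : (0 <= (sqnorm x `^ (p / 2))%:E)%E by rewrite lee_fin powR_ge0.
have B1 : distribution P X (@unit_ball R n) = 1%E.
  have <- : distribution P X (setT : set 'rV[R]_n) = 1%E by exact: probability_setT.
  by rewrite (uniform_in_ballE UX mB) (uniform_in_ballE UX measurableT) setIid setTI.
rewrite /norm_moment (@ge0_negligible_integral _ _ _ _ _ (~` @unit_ball R n))//; first last.
- apply: etrans (probability_setC (distribution P X) mB) _.
  by apply: etrans (congr1 (fun z => 1 - z)%E B1) _; rewrite subee.
- exact: measurableC.
rewrite setTD setCK.
rewrite (@eq_measure_integral _ _ _ _ (mscale (NngNum k0) (lebn n))); last first.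
  move=> A mA AB; apply: etrans (uniform_in_ballE UX mA) _.
  by rewrite (setIidl AB).
rewrite ge0_integral_mscale//; last exact: measurable_funTS.
rewrite integral_mkcond (_ : (\int[lebn n]_x _)%E = ball_moment n p); last first.
  apply: eq_integral => x _; rewrite patchE.
  case: ifPn => [/set_mem xB|/negP xB]; first by rewrite (xB : _ <= 1 = true) mulr1.
  rewrite [X in (_ * (nat_of_bool X)%:R)%:E](_ : _ = false) ?mulr0//.
  by apply/negP => xB'; apply: xB; rewrite inE.
by rewrite ball_momentE// vB -!EFinM; congr EFin; rewrite mulrC mulfK// gt_eqF.
Qed.

Lemma measurable_random_vector n k (X : 'I_k -> {RV P >-> 'rV[R]_n}) :
  measurable_fun setT (fun w => \row_i X i w : 'rV['rV[R]_n]_k).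
Proof.
apply/measurable_fun_rVP => i; under eq_fun do rewrite mxE.
exact: measurable_funP.
Qed.

(** The joint law of independent points is the product of their laws. *)
Lemma integral_independent n k (X : 'I_k -> {RV P >-> 'rV[R]_n})
    (f : 'rV['rV[R]_n]_k -> \bar R) : mutually_independent X ->
  measurable_fun setT f -> (forall W, (0 <= f W)%E) ->
  (\int[P]_w f (\row_i X i w) =
   \int[prod_measure (fun i => distribution P (X i))]_W f W)%E.
Proof.
move=> indep mf f0; have mW := measurable_random_vector X.
rewrite -[RHS](@ge0_integral_image_scale _ _ _ _ R P _ (fun w => \row_i X i w) 1)//.
  by rewrite mul1e.
move=> A mA; rewrite mul1e.
pose nu := measure_function_pushforward__canonical__measure_function_Measure P mW.
rewrite -[LHS]/(nu A); apply: finite_measure_rV_unique => //.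
  by rewrite /nu /= /pushforward preimage_setT probability_setT ltry.
move=> B mB; apply: etrans _ (esym (prod_measure_box _ mB)).
transitivity (\prod_(i in [set: 'I_k]%SET) P (X i @^-1` B i))%E.
  rewrite -indep//; congr (P _); apply/seteqP; split=> w.
    by move=> /= Bw i _; have := Bw i; rewrite mxE.
  by move=> Bw i; rewrite mxE; apply: Bw; rewrite /= inE.
by apply: eq_bigl => i; rewrite inE.
Qed.

End laws.

(** * Moments of the volume *)

Lemma big_ord_rev_shift (R : comNzRingType) (F : nat -> R) k :
  \prod_(1 <= i < k.+1) F i = \prod_(i < k) F (k - i)%N.
Proof.
rewrite big_add1 /= big_mkord (reindex_inj rev_ord_inj) /=.
by apply: eq_bigr => i _; rewrite -subSn ?ltn_ord.
Qed.

Lemma prod_gauss_ratio (R : realType) (n k : nat) (p : R) : (k <= n)%N ->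
  \prod_(1 <= i < k.+1)
     (Gamma ((n%:R - k%:R + i%:R + p) / 2) / Gamma ((n%:R - k%:R + i%:R) / 2)) =
  \prod_(i < k) gauss_ratio p (n - i).
Proof.
move=> kn; rewrite big_ord_rev_shift; apply: eq_bigr => i _; rewrite /gauss_ratio.
have ik : (i <= k)%N by exact: ltnW.
suff -> : n%:R - k%:R + (k - i)%:R = (n - i)%:R :> R by [].
by rewrite !natrB ?(leq_trans ik)// addrA subrK.
Qed.

(** The moment of order [p] of the norm is [n / (n + p)] for the ball; dividing
    by [gauss_ratio p n] produces the Gamma factor of each random point. *)
Lemma ball_gauss_ratio (R : realType) (n : nat) (p : R) : (0 < n)%N -> 0 <= p ->
  n%:R / (n%:R + p) =
  Gamma (1 + n%:R / 2) / Gamma (1 + (n%:R + p) / 2) * gauss_ratio p n.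
Proof.
move=> n0 p0; have n0' : 0 < n%:R :> R by rewrite ltr0n.
have np : 0 < n%:R + p by rewrite ltr_wpDr.
have Gn : Gamma (n%:R / 2 : R) != 0 by rewrite gt_eqF// Gamma_gt0// divr_gt0.
have Gnp : Gamma ((n%:R + p) / 2) != 0 by rewrite gt_eqF// Gamma_gt0// divr_gt0.
rewrite /gauss_ratio !GammaS ?divr_gt0//.
move: (Gamma (n%:R / 2)) (Gamma ((n%:R + p) / 2)) Gn Gnp => a b a0 b0.
by field; rewrite a0 b0 !gt_eqF.
Qed.

Theorem proposition7 (R : realType) (d : measure_display)
    (Omega : measurableType d) (P : probability Omega R)
    (n k s : nat) (X : 'I_k -> {RV P >-> 'rV[R]_n}) (S : {set 'I_k}) (p : R) :
  (1 <= k)%N -> (k <= n)%N -> (s <= k)%N ->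
  mutually_independent X ->
  #|S| = s ->
  (forall i, i \in S -> uniform_on_sphere (X i)) ->
  (forall i, i \notin S -> uniform_in_ball (X i)) ->
  0 <= p ->
  (\int[P]_w (volume k (symmetric_convex_hull (fun i => X i w)) `^ p))%E =
  ((2 ^+ k / k`!%:R) `^ p * (1 + p / n%:R) ^+ s *
   (Gamma (1 + n%:R / 2) / Gamma (1 + (n%:R + p) / 2)) ^+ k *
   \prod_(1 <= i < k.+1)
     (Gamma ((n%:R - k%:R + i%:R + p) / 2) /
      Gamma ((n%:R - k%:R + i%:R) / 2)))%:E.
Proof.
move=> k0 kn _ indep cardS sphX ballX p0.
have n0 : (0 < n)%N by exact: leq_trans kn.
have n0' : 0 < n%:R :> R by rewrite ltr0n.
have np : 0 < n%:R + p by rewrite ltr_wpDr.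
pose c : R := 2 ^+ k / k`!%:R.
have c0 : 0 <= c by rewrite divr_ge0 ?exprn_ge0.
have volE w : (volume k (symmetric_convex_hull (fun i => X i w)) `^ p =
    (c `^ p)%:E * (gram (mx_of_rows (\row_i X i w)) `^ (p / 2))%:E)%E.
  rewrite volume_hull// poweR_EFin -EFinM; congr EFin.
  rewrite (_ : \matrix_i X i w = mx_of_rows (\row_i X i w)); last first.
    by apply/row_matrixP => i; rewrite !rowK mxE.
  rewrite powRM ?sqrtr_ge0//; congr (_ * _).
  by rewrite -powR12_sqrt ?gram_ge0// -powRrM mulrC.
under eq_integral do rewrite volE.
have mW := measurable_random_vector X.
rewrite ge0_integralZl_EFin ?powR_ge0//; last first.
- exact: measurableT_comp (@measurable_gram_powR R k n (p / 2)) mW.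
- by move=> w _; rewrite lee_fin powR_ge0.
rewrite (integral_independent (f := fun W => (gram (mx_of_rows W) `^ (p / 2))%:E))//; first last.
- by move=> W; rewrite lee_fin powR_ge0.
- exact: measurable_gram_powR.
have rotX i : rotation_invariant (distribution P (X i)).
  have [iS|iS] := boolP (i \in S).
    exact/sphere_rotation_invariant/sphX.
  exact/ball_rotation_invariant/ballX.
have := @gram_momentE R k n (fun i => distribution P (X i)) p kn p0 rotX.
rewrite /gram_moment => ->; rewrite prod_gauss_ratio//.
have [b <- bE] : exists2 b, b = Gamma (1 + n%:R / 2) / Gamma (1 + (n%:R + p) / 2) &
    n%:R / (n%:R + p) = b * gauss_ratio p n.
  by exists (Gamma (1 + n%:R / 2) / Gamma (1 + (n%:R + p) / 2)) => //; exact: ball_gauss_ratio.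
have := gauss_ratio_gt0 p0 n0; move: (gauss_ratio p) bE => g bE g_gt0.
have g0 : g n != 0 by rewrite gt_eqF.
have factorE i : (norm_moment (distribution P (X i)) p * (g (n - i)%N / g n)%:E =
    (b * (if i \in S then 1 + p / n%:R else 1) * g (n - i)%N)%:E)%E.
  case: ifPn => iS.
    rewrite sphere_norm_moment; last exact: sphX.
    rewrite mul1e; congr EFin.
    have -> : b = n%:R / (n%:R + p) / g n by rewrite bE mulfK.
    by field; rewrite g0 !gt_eqF.
  rewrite ball_norm_moment//; last exact: ballX.
  by rewrite -EFinM bE mulr1; congr EFin; field.
under eq_bigr do rewrite factorE.
rewrite prodEFin -EFinM; congr EFin; rewrite -[RHS]mulrA -[RHS]mulrA.
congr (_ * _); rewrite big_split big_split /= prodr_const card_ord.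
by rewrite -big_mkcond prodr_const cardS mulrA [b ^+ k * _]mulrC.
Qed.
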